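(* Let $\mathbb{K}\in\{\mathbb{R},\mathbb{C}\}$. For every positive integer $M$ there is a constant $\eta_{M}\geq 1$, depending only on $M$ (and in particular not on $m$), such that for every integer $m\geq M$ and every continuous $m$-linear form $T\colon c_{0}\times\cdots\times c_{0}\rightarrow\mathbb{K}$, $$\left(\sum_{\operatorname{card}(\{i_{1},\ldots,i_{m}\})\leq M}|T(e_{i_{1}},\ldots,e_{i_{m}})|^{\frac{2m}{m+1}}\right)^{\frac{m+1}{2m}}\leq\eta_{M}\Vert T\Vert ,$$ where the sum runs over all $(i_{1},\ldots,i_{m})\in\mathbb{N}^{m}$ such that the set $\{i_{1},\ldots,i_{m}\}$ has at most $M$ elements. Moreover, for real scalars and fixed $m\geq M$, let $\overline{C}_{m,M}^{\mathbb{R}}$ denote the optimal (smallest) constant such that $$\left(\sum_{\operatorname{card}(\{i_{1},\ldots,i_{m}\})\leq M}|T(e_{i_{1}},\ldots,e_{i_{m}})|^{\frac{2m}{m+1}}\right)^{\frac{m+1}{2m}}\leq\overline{C}_{m,M}^{\mathbb{R}}\Vert T\Vert$$ for all continuous $m$-linear forms $T\colon c_0\times\cdots\times c_0\to\mathbb{R}$. Then $$2\leq\liminf_{m\rightarrow\infty}\overline{C}_{m,M}^{\mathbb{R}}\leq\limsup_{m\rightarrow\infty}\overline{C}_{m,M}^{\mathbb{R}}\leq M^{\frac{M+1}{2}}\quad\text{if } M\geq 3,$$ $$\sqrt{2}\leq\liminf_{m\rightarrow\infty}\overline{C}_{m,M}^{\mathbb{R}}\leq\limsup_{m\rightarrow\infty}\overline{C}_{m,M}^{\mathbb{R}}\leq\sqrt{8}\quad\text{if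 } M=2.$$
   Context: $\mathbb{N}=\{1,2,3,\ldots\}$. $c_{0}$ is the Banach space of all $\mathbb{K}$-valued sequences converging to $0$, with the sup norm, and $e_{j}$ denotes its $j$-th canonical unit vector. For a continuous $m$-linear form $T\colon c_{0}\times\cdots\times c_{0}\to\mathbb{K}$ ($m$ factors), $\Vert T\Vert:=\sup\{|T(x^{(1)},\ldots,x^{(m)})| : \Vert x^{(j)}\Vert=1 \text{ for all } j=1,\ldots,m\}$. $\operatorname{card}(A)$ is the cardinality of a set $A$; $\{i_1,\ldots,i_m\}$ is regarded as a set, so repeated indices are counted once. *)

(* Defs.v *)
From HB Require Import structures.
From mathcomp Require Import all_boot all_order all_algebra.
From mathcomp Require Import all_classical all_reals all_analysis.
From mathcomp Require Import complex.

Set Implicit Arguments.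
Unset Strict Implicit.
Unset Printing Implicit Defensive.

Import Order.TTheory GRing.Theory Num.Theory.
Import numFieldNormedType.Exports.

Local Open Scope classical_set_scope.
Local Open Scope ring_scope.

(* Everything about c_0 is done over an arbitrary numFieldType K, which covers
   both K = R and K = R[i] for R : realType. The norm of a normedModType K
   takes its values in K itself; [supremum] is the least upper bound for the
   (partial) order of K. Sequences are indexed from 0. *)

Section c0.
Variable K : numFieldType.

Definition null_seq : {pred nat -> K} :=
  [pred x : nat -> K | `[< x n @[n --> \oo] --> (0 : K) >]].

Lemma null_seqP (x : nat -> K) :
  (x \in null_seq) <-> (x n @[n --> \oo] --> (0 : K)).
Proof. by rewrite unfold_in /=; split => /asboolP. Qed.

Lemma null_seq_submod_closed : submod_closed null_seq.
Proof.
split; first by apply/null_seqP; exact: cvg_cst.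
move=> a x y /null_seqP cx /null_seqP cy; apply/null_seqP.
rewrite -[0]addr0; apply: cvgD; last exact: cy.
by rewrite -[0](mulr0 a); apply: cvgM; [exact: cvg_cst|exact: cx].
Qed.

HB.instance Definition _ :=
  GRing.isSubmodClosed.Build K (nat -> K) null_seq null_seq_submod_closed.

Record c0 := C0 { c0_seq :> nat -> K; c0_seqP : c0_seq \in null_seq }.

HB.instance Definition _ := [isSub for c0_seq].
HB.instance Definition _ := [Choice of c0 by <:].
HB.instance Definition _ := [SubChoice_isSubLmodule of c0 by <:].

Definition c0_norm (x : c0) : K := supremum 0 (range (fun n => `|x n|)).

Lemma c0_max (x : c0) : exists n0, forall n, `|x n| <= `|x n0|.
Proof.
have fin_max N : exists n0, forall n, (n <= N)%N -> `|x n| <= `|x n0|.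
  elim: N => [|N [n0 IH]]; first by exists 0%N => n; rewrite leqn0 => /eqP ->.
  have [le|lt] := real_leP (normr_real (x N.+1)) (normr_real (x n0)).
    by exists n0 => n; rewrite leq_eqVlt => /predU1P[->//|]; exact: IH.
  exists N.+1 => n; rewrite leq_eqVlt => /predU1P[->//|nN].
  exact: le_trans (IH _ nN) (ltW lt).
have [x0|/existsNP[k /eqP xk]] := pselect (forall n, x n = 0).
  by exists 0%N => n; rewrite !x0.
have /null_seqP/cvgr0Pnorm_lt/(_ `|x k|) := c0_seqP x.
rewrite normr_gt0 => /(_ xk)[N _ xN].
have [n0 Hn0] := fin_max (maxn N k).
exists n0 => n; have [nN|Nn] := leqP n (maxn N k); first exact: Hn0.
apply: le_trans (Hn0 k (leq_maxr _ _)); apply/ltW/xN => /=.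
exact: leq_trans (leq_maxl N k) (ltnW Nn).
Qed.

Lemma c0_normP (x : c0) : exists2 n0, c0_norm x = `|x n0| &
  forall n, `|x n| <= `|x n0|.
Proof.
have [n0 n0max] := c0_max x; exists n0 => //; rewrite /c0_norm /supremum.
case: ifPn => [/eqP A0|_].
  have : range (fun n => `|x n|) `|x n0| by exists n0.
  by rewrite A0.
have sn0 : supremums (range (fun n => `|x n|)) `|x n0|.
  by split=> [_ [n _ <-]//|y]; apply; exists n0.
exact: is_subset1_supremums (xgetPex _ (ex_intro _ _ sn0)) sn0.
Qed.

Lemma c0_normD (x y : c0) : c0_norm (x + y) <= c0_norm x + c0_norm y.
Proof.
have [n -> _] := c0_normP (x + y).
have [p -> px] := c0_normP x; have [q -> qy] := c0_normP y.
exact: le_trans (ler_normD _ _) (lerD (px n) (qy n)).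
Qed.

Lemma c0_normZ (a : K) (x : c0) : c0_norm (a *: x) = `|a| * c0_norm x.
Proof.
have [n -> nx] := c0_normP (a *: x); have [p -> px] := c0_normP x.
apply/le_anti/andP; split.
  by rewrite [leLHS](_ : _ = `|a| * `|x n|) ?ler_wpM2l// -normrM.
by rewrite -normrM; exact: nx.
Qed.

Lemma c0_norm0_eq0 (x : c0) : c0_norm x = 0 -> x = 0.
Proof.
have [n -> nx] := c0_normP x => xn0; apply/val_inj/funext => k /=.
by apply/eqP; rewrite -normr_le0 -xn0.
Qed.

HB.instance Definition _ :=
  Lmodule_isNormed.Build K c0 c0_normD c0_normZ c0_norm0_eq0.

Lemma unitv_subproof (j : nat) : (fun n => (n == j)%:R : K) \in null_seq.
Proof.
apply/null_seqP; apply: cvg_near_cst; exists j.+1 => // n /= jn.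
by rewrite gtn_eqF.
Qed.

Definition unitv (j : nat) : c0 := C0 (unitv_subproof j).

Definition multilinear_form (m : nat) (T : ('I_m -> c0) -> K) :=
  forall (k : 'I_m) (x : 'I_m -> c0),
    linear_for *%R (fun u : c0 => T (dfwith x k u)).

End c0.

(* [abs] is the absolute value of K read as an element of R: Num.norm when
   K = R, and the modulus normc when K = R[i]. *)
Section restricted_Bohnenblust_Hille.
Variables (R : realType) (K : numFieldType) (abs : K -> R).

Definition form_norm (m : nat) (T : ('I_m -> c0 K) -> K) : R :=
  sup [set abs (T x) | x in [set x | forall j, `|x j| = 1]].

Definition few_indices {m} (M : nat) : set {ffun 'I_m -> nat} :=
  [set i | (range i #<= `I_M)%card].

Definition restricted_sum {m} (M : nat) (T : ('I_m -> c0 K) -> K) : \bar R :=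
  \esum_(i in few_indices M)
    (abs (T (fun j : 'I_m => unitv K (i j))) `^ ((2 * m)%:R / m.+1%:R))%:E.

(* The topology on the m-fold product is the product topology. *)
Definition restricted_BH (m M : nat) (C : R) :=
  forall T : {ptws 'I_m -> c0 K} -> K, multilinear_form T -> continuous T ->
    (poweR (restricted_sum M T) (m.+1%:R / (2 * m)%:R)
       <= (C * form_norm T)%:E)%E.

Definition optimal_BH (m M : nat) : \bar R :=
  ereal_inf [set C%:E | C in restricted_BH m M].

End restricted_Bohnenblust_Hille.

(* Main.v *)
(** For the upper bound, write an index tuple with at most [M] entries as
    [j o P] with [P : [m] -> [M]] onto (possible because [m >= M]).  Averaging
    over signs, the [M]-linear array [j |-> T(e_(j o P))] is still bounded by
    [||T||], so Khinchine's inequality gives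
    [sum_v alpha_(P,k)(v) <= c_M ||T||] for the [l_2]-norms [alpha_(P,k)(v)] of
    its slices [j_k = v].  With [||T|| = 1] and [x = |T(e_(j o P))|], apply the
    arithmetic-geometric mean inequality to the [m + 1] numbers
    [A x^2 / alpha_(P,k)(j_k)] ([M] of them), [A prod_k alpha_(P,k)(j_k)] and
    [B x^2] ([m - M] times), where [A = M^(M-m)] and [B = M^(M+1)]: their product
    is [x^(2m)].  The first [M + 1] terms are summed over at most [M^m] maps [P],
    which [A] compensates; the last ones are summed by Parseval with constant 1.
    The result is a constant that tends to [M^(M+1)] before the power
    [(m+1)/(2m)] is taken.

    For the lower bound, for [b] in [{0,1}^h], the products
    [prod_(l < h) (x_l(0) + (-1)^(b_l) x_l(1))] have absolute values summing to
    at most [2^h]; multiplying each by coordinates of the other variables that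
    determine [b] and summing over [b] gives a form of norm at most [2^h] with
    [4^h] coefficients of modulus 1, whence a ratio of [2^(h/m)].  Three indices
    allow [h = m - 1], two indices allow [h = m/2]. *)
Require Import Defs.
From mathcomp Require Import all_boot all_order all_algebra.
From mathcomp Require Import all_classical all_reals all_analysis.
From mathcomp Require Import complex.
From mathcomp Require Import ring lra.

Set Implicit Arguments.
Unset Strict Implicit.
Unset Printing Implicit Defensive.

Import Order.TTheory GRing.Theory Num.Theory.
Import numFieldNormedType.Exports.

Local Open Scope classical_set_scope.
Local Open Scope ring_scope.

(** * Means over signs *)

Section sign_means.
Variables (R : realType) (I : finType).
Local Notation bits := {ffun I -> bool}.
Implicit Types (f g : bits -> R) (s : bits).

Definition sgb (b : bool) : R := (-1) ^+ b.

Lemma sgbN b : sgb (~~ b) = - sgb b.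
Proof. by case: b; rewrite /sgb ?expr0 ?expr1 ?opprK. Qed.

Lemma sgb_sqr b : sgb b * sgb b = 1.
Proof. by rewrite -expr2 sqrr_sign. Qed.

Definition mean f : R := (\sum_s f s) / #|{: bits}|%:R.

Lemma card_bits_gt0 : 0 < #|{: bits}|%:R :> R.
Proof. by rewrite ltr0n; apply/card_gt0P; exists [ffun=> true]. Qed.

Lemma eq_mean f g : f =1 g -> mean f = mean g.
Proof. by move=> fg; congr (_ / _); apply: eq_bigr => s _. Qed.

Lemma mean_cst c : mean (fun=> c) = c.
Proof.
rewrite /mean sumr_const -[c *+ _]mulr_natr; apply: mulfK.
by rewrite gt_eqF// card_bits_gt0.
Qed.

Lemma meanD f g : mean (fun s => f s + g s) = mean f + mean g.
Proof. by rewrite /mean big_split mulrDl. Qed.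

Lemma meanZ c f : mean (fun s => c * f s) = c * mean f.
Proof. by rewrite /mean -mulr_sumr mulrA. Qed.

Lemma mean_sum (J : Type) (r : seq J) (P : pred J) (F : J -> bits -> R) :
  mean (fun s => \sum_(j <- r | P j) F j s) = \sum_(j <- r | P j) mean (F j).
Proof. by rewrite /mean exchange_big mulr_suml. Qed.

Lemma ler_mean f g : (forall s, f s <= g s) -> mean f <= mean g.
Proof.
move=> fg; apply: ler_wpM2r; first by rewrite invr_ge0 ltW// card_bits_gt0.
by apply: ler_sum => s _.
Qed.

Lemma mean_ge0 f : (forall s, 0 <= f s) -> 0 <= mean f.
Proof. by move=> f0; rewrite -(mean_cst 0); exact: ler_mean. Qed.

Definition flip (i : I) (s : bits) : bits :=
  [ffun x => if x == i then ~~ s x else s x].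

Lemma flipK i : involutive (flip i).
Proof.
by move=> s; apply/ffunP => x; rewrite !ffunE; case: eqP => //; rewrite negbK.
Qed.

Lemma mean_odd i f : (forall s, f (flip i s) = - f s) -> mean f = 0.
Proof.
move=> fN; rewrite /mean; apply/eqP; rewrite mulf_eq0; apply/orP; left.
have : \sum_s f s = - \sum_s f s.
  rewrite {1}(reindex_inj (inv_inj (flipK i))) -sumrN.
  by apply: eq_bigr => s _; rewrite fN.
by move=> e; apply/eqP; lra.
Qed.

(** The quadratic [t |-> mean ((f + t g)^2)] is nonnegative; its value at the minimiser [- c / b] is
    the discriminant bound. *)
Lemma mean_cauchy f g :
  mean (fun s => f s * g s) ^+ 2 <= mean (fun s => f s ^+ 2) * mean (fun s => g s ^+ 2).
Proof.
set a := mean (fun s => f s ^+ 2); set b := mean (fun s => g s ^+ 2).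
set c := mean _.
have a0 : 0 <= a by apply: mean_ge0 => s; rewrite sqr_ge0.
have quad t : 0 <= a + 2 * t * c + t ^+ 2 * b.
  rewrite -!meanZ -!meanD; apply: mean_ge0 => s.
  by rewrite (_ : _ + _ = (f s + t * g s) ^+ 2) ?sqr_ge0//; ring.
have b0 : 0 <= b by apply: mean_ge0 => s; rewrite sqr_ge0.
have [b00|bN0] := eqVneq b 0.
  (* With [b = 0] the quadratic is affine in [t], and for [c <> 0] the point chosen here would give
     it the value [-1]. *)
  have [-> |cN0] := eqVneq c 0; first by rewrite expr0n mulr_ge0.
  have := quad (- (a + 1) / (2 * c)).
  rewrite b00 mulr0 addr0 (_ : 2 * _ * c = - (a + 1)); first by lra.
  by field.
have bp : 0 < b by rewrite lt_def bN0.
have := quad (- c / b).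
rewrite (_ : _ + _ = (a * b - c ^+ 2) / b); last by field.
by rewrite pmulr_lge0 ?invr_gt0// subr_ge0.
Qed.

(* [low r d f]: [f] is a polynomial of degree at most [d] in the signs indexed by
   [r], split as [Y + s_i Z] at the first index. *)
Fixpoint low (r : seq I) (d : nat) f : Prop :=
  if r is i :: r' then exists Y Z : bits -> R,
    [/\ low r' d Y, (if d is d'.+1 then low r' d' Z else Z =1 fun=> 0) &
        forall s, f s = Y s + sgb (s i) * Z s]
  else exists c, f =1 fun=> c.

Lemma low0 r d f : f =1 (fun=> 0) -> low r d f.
Proof.
elim: r d f => [|i r IH] d f f0 /=; first by exists 0.
exists (fun=> 0), (fun=> 0); split; first exact: IH.
- by case: d => // d; exact: IH.
- by move=> s; rewrite mulr0 addr0.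
Qed.

Lemma lowZ r d c f g : low r d f -> g =1 (fun s => c * f s) -> low r d g.
Proof.
elim: r d f g => [|i r IH] d f g /=.
  by move=> [b fb] gE; exists (c * b) => s; rewrite gE fb.
move=> [Y [Z [lY lZ fE]]] gE; exists (fun s => c * Y s), (fun s => c * Z s).
split; first exact: IH lY _.
- by case: d lZ {lY} => [Z0 s|d lZ]; [rewrite Z0 mulr0|exact: IH lZ _].
- by move=> s; rewrite gE fE; ring.
Qed.

Lemma lowD r d f g h : low r d f -> low r d g -> h =1 (fun s => f s + g s) ->
  low r d h.
Proof.
elim: r d f g h => [|i r IH] d f g h /=.
  by move=> [b fb] [c gc] hE; exists (b + c) => s; rewrite hE fb gc.
move=> [Y [Z [lY lZ fE]]] [Y' [Z' [lY' lZ' gE]]] hE.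
exists (fun s => Y s + Y' s), (fun s => Z s + Z' s); split.
- exact: IH lY lY' _.
- case: d lZ lZ' {lY lY'} => [Z0 Z0' s|d lZ lZ']; last exact: IH lZ lZ' _.
  by rewrite Z0 Z0' addr0.
- by move=> s; rewrite hE fE gE; ring.
Qed.

Lemma low_sum (J : Type) (js : seq J) r d (F : J -> bits -> R) :
  (forall j, low r d (F j)) -> low r d (fun s => \sum_(j <- js) F j s).
Proof.
move=> lF; elim: js => [|j js IH]; first by apply: low0 => s; rewrite big_nil.
by apply: lowD (lF j) IH _ => s; rewrite big_cons.
Qed.

(** An index chosen by [A] sends the remaining product to [Z] and uses up one degree; any other
    index sends it to [Y]. *)
Lemma low_monomial r d (A : pred I) : (count A r <= d)%N ->
  low r d (fun s => \prod_(i <- r) if A i then sgb (s i) else 1).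
Proof.
elim: r d => [|i r IH] d /=; first by exists 1 => s; rewrite big_nil.
pose h s := \prod_(j <- r) if A j then sgb (s j) else 1.
case Ai: (A i) => /=.
  case: d => // d; rewrite add1n ltnS => /IH lh.
  exists (fun=> 0), h; split => //; first exact: low0.
  by move=> s; rewrite big_cons Ai add0r.
rewrite add0n => /IH lh; exists h, (fun=> 0); split => //.
  by case: (d) => // d'; exact: low0.
by move=> s; rewrite big_cons Ai mulr0 addr0 mul1r.
Qed.

(** A polynomial in the signs of [r] ignores all other signs. This makes [Y] and [Z] invariant under
    the flip of the index split off. *)
Lemma low_flip r d f i : low r d f -> i \notin r ->
  forall s, f (flip i s) = f s.
Proof.
elim: r d f => [|j r IH] d f /=; first by move=> [c fc] _ s; rewrite !fc.
move=> [Y [Z [lY lZ fE]]]; rewrite inE negb_or => /andP[ij ir] s.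
rewrite !fE (IH _ _ lY)// ffunE eq_sym (negbTE ij); congr (_ + _ * _).
by case: d lZ {lY} => [Z0|d /IH->//]; rewrite !Z0.
Qed.

(** Bonami's inequality between the fourth and second moments of a polynomial of degree [d]. In the
    powers of [Y + s_i Z] the terms odd in [s_i] have mean 0; the mixed term [Y^2 Z^2] is handled by
    Cauchy-Schwarz and induction. *)
Lemma low_bonami r d f : uniq r -> low r d f ->
  mean (fun s => f s ^+ 4) <= 9 ^+ d * mean (fun s => f s ^+ 2) ^+ 2.
Proof.
elim: r d f => [|i r IH] d f /=.
  move=> _ [c fc]; rewrite (eq_mean (g := fun=> c ^+ 4)); last by move=> s /=; rewrite fc.
  rewrite (@eq_mean (fun s => f s ^+ 2) (fun=> c ^+ 2)); last by move=> s /=; rewrite fc.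
  rewrite !mean_cst -exprM ler_peMl ?exprn_even_ge0// exprn_ege1//.
  by rewrite ler1n.
move=> /andP[ir ur] [Y [Z [lY lZ fE]]].
case: d lY lZ => [lY Z0|d lY lZ].
  have fY : f =1 Y by move=> s; rewrite fE Z0 mulr0 addr0.
  rewrite (@eq_mean _ (fun s => Y s ^+ 4)); last by move=> s /=; rewrite fY.
  rewrite (@eq_mean (fun s => _ ^+ 2) (fun s => Y s ^+ 2)); last by move=> s /=; rewrite fY.
  exact: IH.
have Yi := low_flip lY ir; have Zi := low_flip lZ ir.
have sgi s : sgb (flip i s i) = - sgb (s i) by rewrite ffunE eqxx sgbN.
have bY := IH _ _ ur lY; have bZ := IH _ _ ur lZ.
set y := mean (fun s => Y s ^+ 2) in bY; set z := mean (fun s => Z s ^+ 2) in bZ.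
have y0 : 0 <= y by apply: mean_ge0 => s; rewrite sqr_ge0.
have z0 : 0 <= z by apply: mean_ge0 => s; rewrite sqr_ge0.
have -> : mean (fun s => f s ^+ 2) = y + z.
  rewrite (@eq_mean _ (fun s => Y s ^+ 2 + Z s ^+ 2 + 2 * (sgb (s i) * (Y s * Z s)))).
    rewrite !meanD meanZ (@mean_odd i (fun s => sgb _ * _)) ?mulr0 ?addr0//.
    by move=> s /=; rewrite sgi Yi Zi mulNr.
  move=> s /=; rewrite fE; have := sgb_sqr (s i).
  by move: (sgb _) => e e2; ring: e2.
have -> : mean (fun s => f s ^+ 4) =
    mean (fun s => Y s ^+ 4) + 6 * mean (fun s => Y s ^+ 2 * Z s ^+ 2)
    + mean (fun s => Z s ^+ 4).
  rewrite (@eq_mean _ (fun s => Y s ^+ 4 + 6 * (Y s ^+ 2 * Z s ^+ 2) + Z s ^+ 4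
      + sgb (s i) * (4 * Y s ^+ 3 * Z s + 4 * Y s * Z s ^+ 3))).
    rewrite !meanD meanZ (@mean_odd i (fun s => sgb _ * _)) ?addr0//.
    by move=> s /=; rewrite sgi !Yi !Zi mulNr.
  move=> s /=; rewrite fE; have := sgb_sqr (s i).
  by move: (sgb _) => e e2; ring: e2.
set w := mean (fun s => Y s ^+ 2 * Z s ^+ 2).
have := mean_cauchy (fun s => Y s ^+ 2) (fun s => Z s ^+ 2); rewrite -/w.
rewrite (@eq_mean _ (fun s => Y s ^+ 4)); last by move=> s /=; rewrite -exprM.
rewrite (@eq_mean (fun s => (Z s ^+ 2) ^+ 2) (fun s => Z s ^+ 4)); last first.
  by move=> s /=; rewrite -exprM.
have Y40 : 0 <= mean (fun s => Y s ^+ 4) by apply: mean_ge0 => s; rewrite exprn_even_ge0.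
have Z40 : 0 <= mean (fun s => Z s ^+ 4) by apply: mean_ge0 => s; rewrite exprn_even_ge0.
move: bY bZ Y40 Z40.
move: (mean (fun s => Y s ^+ 4)) (mean (fun s => Z s ^+ 4)) => Y4 Z4.
have Dp : 0 <= (9 : R) ^+ d by rewrite exprn_ge0.
rewrite exprS; move: (9 ^+ d) Dp => D D0 bY bZ Y40 Z40 cs.
clearbody y z.
(* Cauchy-Schwarz and the two induction hypotheses give [w^2 <= (9 D y^2) (D z^2)], since [Z] has
   one degree less than [Y]. *)
have wle : w <= 3 * D * y * z.
  have w0 : 0 <= w by apply: mean_ge0 => s; rewrite mulr_ge0 ?sqr_ge0.
  have w'0 : 0 <= 3 * D * y * z by rewrite !mulr_ge0.
  rewrite -(@ler_pXn2r _ 2)//.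
  apply: le_trans cs (le_trans (ler_pM _ _ bY bZ) _) => //.
  by rewrite le_eqVlt; apply/orP; left; apply/eqP; ring.
nra.
Qed.
End sign_means.

(** * Arrays bounded on signs *)

Section khinchine.
Variables (R : realType) (I : finType).
Implicit Types f : {ffun I -> bool} -> R.

(** A fourth moment bound turns into a first moment bound by averaging a pointwise polynomial
    inequality. The scale [u] is chosen so that Bonami's inequality reads [m4 <= u^2 m2]; the
    outcome is [3 t <= 4 3^d m1]. *)
Lemma low_khinchine (r : seq I) d f : uniq r -> low r d f ->
  Num.sqrt (mean (fun s => f s ^+ 2)) <= 2 * 3 ^+ d * mean (fun s => `|f s|).
Proof.
move=> ur lf; have := low_bonami ur lf.
set m1 := mean (fun s => `|f s|); set m2 := mean (fun s => f s ^+ 2).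
set m4 := mean (fun s => f s ^+ 4) => bon.
have m20 : 0 <= m2 by apply: mean_ge0 => s; rewrite sqr_ge0.
have m10 : 0 <= m1 by apply: mean_ge0.
have := sqr_sqrtr m20; have := sqrtr_ge0 m2; move: (Num.sqrt m2) => t t0 t2.
have k0 : 0 < (3 : R) ^+ d by rewrite exprn_gt0.
have [->|tN0] := eqVneq t 0; first by apply: mulr_ge0 => //; rewrite mulr_ge0// ltW.
have tp : 0 < t by rewrite lt_def tN0.
set u := t * 3 ^+ d.
have up : 0 < u by rewrite mulr_gt0.
(* y - y^2 + y^4 / 4 >= 0 for y >= 0, applied to y = |f s| / u *)
have key : 4 * u ^+ 2 * m2 - m4 <= 4 * u ^+ 3 * m1.
  rewrite lerBlDr -!meanZ -meanD; apply: ler_mean => s.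
  rewrite -(real_normK (num_real (f s))).
  rewrite (_ : f s ^+ 4 = `|f s| ^+ 4); last first.
    by rewrite -[RHS]normrX ger0_norm// exprn_even_ge0.
  have := normr_ge0 (f s); move: `|f s| => y y0.
  rewrite -subr_ge0.
  have -> : 4 * u ^+ 3 * y + y ^+ 4 - 4 * u ^+ 2 * y ^+ 2 =
    y * ((y + 2 * u) * (y - u) ^+ 2 + u ^+ 2 * (2 * u - y)) by ring.
  apply: mulr_ge0 => //.
  (* For [y <= 2 u] both summands are nonnegative; beyond, [(y - u)^2 >= u^2] and [y + 2 u]
     outweighs [y - 2 u]. *)
  have [yu|uy] := leP y (2 * u).
    apply: addr_ge0; apply: mulr_ge0; rewrite ?sqr_ge0 ?subr_ge0//.
    by apply: addr_ge0 => //; apply: mulr_ge0 => //; exact: ltW.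
  have : u ^+ 2 <= (y - u) ^+ 2.
    rewrite ler_pXn2r ?nnegrE//; lra.
  have : 0 <= (y - u) ^+ 2 by rewrite sqr_ge0.
  have : 0 <= u ^+ 2 by rewrite sqr_ge0.
  by move: ((y - u) ^+ 2) (u ^+ 2) => A B A0 B0 BA; nra.
have e9 : (9 : R) ^+ d = 3 ^+ d * 3 ^+ d.
  by rewrite -exprMn -natrM.
move: key bon; rewrite e9 -t2 /u; move: (3 ^+ d) k0 => k k0 key bon.
have : 4 * (t * k) ^+ 2 * t ^+ 2 - k * k * (t ^+ 2) ^+ 2 <= 4 * (t * k) ^+ 3 * m1.
  by apply: le_trans key; rewrite lerD2l lerN2.
have -> : 4 * (t * k) ^+ 2 * t ^+ 2 - k * k * (t ^+ 2) ^+ 2 = (t * k) ^+ 2 * t * (3 * t) by ring.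
have -> : 4 * (t * k) ^+ 3 * m1 = (t * k) ^+ 2 * t * (4 * k * m1) by ring.
have pp : 0 < (t * k) ^+ 2 * t by rewrite mulr_gt0// exprn_gt0// mulr_gt0.
rewrite ler_pM2l// => h.
have : 0 <= k * m1 by rewrite mulr_ge0// ltW.
by lra.
Qed.
End khinchine.

Lemma sgb_addb (R : realType) : {morph sgb R : b c / b (+) c >-> b * c}.
Proof. by move=> b c; exact: signr_addb. Qed.

Lemma sgb_false (R : realType) : sgb R false = 1.
Proof. exact: expr0. Qed.

Section sign_forms.
Variables (R : realType) (U V : finType).
Implicit Types (a : {ffun U -> V} -> R) (i : {ffun U -> V}) (L : R).

(** The multilinear form with coefficients [a], evaluated at sign vectors: variable [l] has the sign
    [s l v] as its coordinate [v]. *)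
Definition signform a (s : U -> V -> bool) : R :=
  \sum_i a i * \prod_l sgb R (s l (i l)).

Definition sign_bounded a L := forall s, `|signform a s| <= L.

Local Notation bits := {ffun U * V -> bool}.
Local Notation uncur s := (fun l v => (s : bits) (l, v)).

Lemma prod_sgb_flip (l0 : U) (s : bits) v0 i :
  \prod_l sgb R (flip (l0, v0) s (l, i l)) =
  (if i l0 == v0 then -1 else 1) * \prod_l sgb R (s (l, i l)).
Proof.
rewrite (bigD1 l0)//= [in RHS](bigD1 l0)//= mulrA; congr (_ * _).
  rewrite ffunE xpair_eqE eqxx /=; case: eqP => _; rewrite ?mul1r//.
  by rewrite sgbN mulN1r.
by apply: eq_bigr => l ll0; rewrite ffunE xpair_eqE (negbTE ll0).
Qed.

Lemma mean_prod_sgb i i' :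
  mean (fun s : bits => \prod_l sgb R (s (l, i l)) * \prod_l sgb R (s (l, i' l)))
  = (i == i')%:R.
Proof.
have [<-|ii'] := eqVneq i i'.
  rewrite (@eq_mean _ _ _ (fun=> 1)) ?mean_cst// => s.
  by rewrite -big_split big1//= => l _; rewrite sgb_sqr.
have [l0 il0] : exists l0, i l0 != i' l0.
  by apply/existsP; apply: contraNT ii'; rewrite negb_exists => /forallP h;
    apply/eqP/ffunP => l; apply/eqP/negPn.
apply: (@mean_odd _ _ (l0, i l0)) => s.
by rewrite !prod_sgb_flip eqxx eq_sym (negbTE il0) mul1r mulN1r mulNr.
Qed.

(** Parseval: the sign monomials of distinct indices are orthonormal. *)
Lemma mean_signform_sqr a :
  mean (fun s : bits => signform a (uncur s) ^+ 2) = \sum_i a i ^+ 2.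
Proof.
pose F i (s : bits) := \prod_l sgb R (s (l, i l)).
rewrite (@eq_mean _ _ _ (fun s =>
  \sum_i \sum_i' a i * a i' * (F i s * F i' s))); last first.
  move=> s; rewrite expr2 /signform mulr_suml; apply: eq_bigr => i _.
  by rewrite mulr_sumr; apply: eq_bigr => i' _; rewrite mulrACA.
rewrite mean_sum; apply: eq_bigr => i _; rewrite mean_sum (bigD1 i)//= big1.
  by rewrite meanZ mean_prod_sgb eqxx mulr1 addr0 expr2.
by move=> i' ii'; rewrite meanZ mean_prod_sgb eq_sym (negbTE ii') mulr0.
Qed.

Lemma sign_bounded_ge0 a L : sign_bounded a L -> 0 <= L.
Proof. by move=> /(_ (fun _ _ => true)); exact: le_trans. Qed.

Lemma sign_bounded_l2 a L : sign_bounded a L -> \sum_i a i ^+ 2 <= L ^+ 2.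
Proof.
move=> aL; rewrite -mean_signform_sqr -[leRHS](@mean_cst _ (U * V)%type).
apply: ler_mean => s; rewrite -(real_normK (num_real (signform _ _))).
by rewrite ler_pXn2r ?nnegrE ?(sign_bounded_ge0 aL).
Qed.

Lemma low_signform a :
  low (enum {: U * V}) #|U| (fun s : bits => signform a (uncur s)).
Proof.
apply: low_sum => i.
have lm := @low_monomial R (U * V)%type (enum {: U * V}) #|U|
  (fun x => x.2 == i x.1).
apply: (lowZ (c := a i) (lm _)).
  (* A monomial uses one sign per variable: the pairs counted are the image of [l |-> (l, i l)],
     hence the degree [#|U|]. *)
  have /card_uniqP uf : uniq [seq x <- enum {: U * V} | x.2 == i x.1].
    by rewrite filter_uniq ?enum_uniq.
  rewrite -size_filter -uf.
  rewrite -(@fintype.card_image _ _ (fun l => (l, i l))) => [|l l' []//].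
  apply: subset_leq_card; apply/fintype.subsetP => -[l v].
  rewrite mem_filter /= => /andP[/eqP -> _].
  by apply/fintype.imageP; exists l.
move=> s; congr (_ * _); rewrite big_enum /=.
transitivity (\prod_l \prod_v if v == i l then sgb R (s (l, v)) else 1).
  by apply: eq_bigr => l _; rewrite -big_mkcond big_pred1_eq.
by rewrite pair_bigA; apply: eq_bigr => -[l v] _.
Qed.

Lemma signform_khinchine a :
  Num.sqrt (\sum_i a i ^+ 2) <=
  2 * 3 ^+ #|U| * mean (fun s : bits => `|signform a (uncur s)|).
Proof.
rewrite -mean_signform_sqr.
exact: low_khinchine (enum_uniq _) (low_signform a).
Qed.

(* The sign of each slice is absorbed into the signs of the variable k. *)
Lemma sign_bounded_mixed a L (k : U) : sign_bounded a L ->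
  \sum_v Num.sqrt (\sum_(i : {ffun U -> V} | i k == v) a i ^+ 2) <= 2 * 3 ^+ #|U| * L.
Proof.
move=> aL; pose b v i := if i k == v then a i else 0.
have -> : \sum_v Num.sqrt (\sum_(i : {ffun U -> V} | i k == v) a i ^+ 2) =
    \sum_v Num.sqrt (\sum_i b v i ^+ 2).
  apply: eq_bigr => v _; congr Num.sqrt; rewrite big_mkcond.
  by apply: eq_bigr => i _; rewrite /b; case: eqP; rewrite ?expr0n.
apply: le_trans (ler_sum _ (fun v _ => signform_khinchine (b v))) _.
rewrite -mulr_sumr ler_wpM2l ?mulr_ge0 ?exprn_ge0//.
(* All slices share the same random signs, so their sum may be bounded for each choice of signs
   separately. *)
rewrite -mean_sum -[leRHS](@mean_cst _ (U * V)%type); apply: ler_mean => s.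
pose s' l v := if l == k then s (l, v) (+) (signform (b v) (uncur s) < 0)
  else s (l, v).
rewrite (_ : \sum_v _ = signform a s').
  by apply: le_trans (ler_norm _) (aL s').
rewrite /signform (partition_big (fun i : {ffun U -> V} => i k) xpredT)//=.
apply: eq_bigr => v _.
rewrite (_ : \sum_(i : {ffun U -> V} | i k == v) _ =
    sgb R (signform (b v) (uncur s) < 0) * signform (b v) (uncur s)).
  by case: ltP => h; rewrite /sgb ?expr0 ?expr1 ?mul1r ?mulN1r;
    [rewrite ltr0_norm|rewrite ger0_norm].
rewrite [in RHS]/signform mulr_sumr big_mkcond; apply: eq_bigr => i _.
rewrite /b; case: eqP => [ikv|_]; last by rewrite mul0r mulr0.
rewrite mulrCA; congr (_ * _).
rewrite (bigD1 k)//= [in RHS](bigD1 k)//= mulrA; congr (_ * _).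
  by rewrite /s' eqxx ikv /sgb signr_addb mulrC.
by apply: eq_bigr => l lk; rewrite /s' (negbTE lk).
Qed.
End sign_forms.

(* Fix a representative in each fibre of [P] and multiply its sign by the random
   signs of the rest of the fibre: averaging then kills every index that is not
   constant on the fibres. *)
Lemma sign_bounded_comp (R : realType) (U W V : finType)
    (a : {ffun U -> V} -> R) L (P : {ffun U -> W}) :
  (forall k, exists l, P l = k) -> sign_bounded a L ->
  sign_bounded (fun j : {ffun W -> V} => a [ffun l => j (P l)]) L.
Proof.
move=> Ponto aL s.
have Pex k : exists l, P l == k by have [l /eqP] := Ponto k; exists l.
pose rep k := xchoose (Pex k).
have repK k : P (rep k) = k by apply/eqP; exact: (xchooseP (Pex k)).
pose t (e : {ffun U * V -> bool}) l v := if l == rep (P l)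
  then s (P l) v (+) \big[addb/false]_(l' | (P l' == P l) && (l' != l)) e (l', v)
  else e (l, v).
(* [G i] is the contribution of the random signs at the index [i]: its mean is 1 if [i] is constant
   on the fibres of [P], and 0 otherwise. *)
pose G (i : {ffun U -> V}) (e : {ffun U * V -> bool}) :=
  \prod_(l | l != rep (P l)) (sgb R (e (l, i (rep (P l)))) * sgb R (e (l, i l))).
have tE (i : {ffun U -> V}) e : \prod_l sgb R (t e l (i l)) =
    (\prod_k sgb R (s k (i (rep k)))) * G i e.
  rewrite /G [in RHS](partition_big P xpredT)//= -big_split/=.
  rewrite (partition_big P xpredT)//=; apply: eq_bigr => k _.
  rewrite (bigD1 (rep k)) ?repK//= /t repK eqxx sgb_addb -mulrA.
  congr (_ * _); rewrite (big_morph (sgb R) (@sgb_addb R) (sgb_false R)).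
  rewrite [RHS](eq_bigl (fun l => (P l == k) && (l != rep k))); last first.
    by move=> l /=; rewrite andbC; have [->|] := eqVneq (P l) k.
  by rewrite -big_split; apply: eq_bigr => l /= /andP[/eqP -> /negbTE ->].
have G1 (i : {ffun U -> V}) : mean (G i) = [forall l, i l == i (rep (P l))]%:R.
  have [/forallP iP|/forallPn[l0 il0]] := boolP [forall l, i l == i (rep (P l))].
    rewrite (@eq_mean _ _ _ (fun=> 1)) ?mean_cst// => e.
    by rewrite /G big1// => l _; rewrite -(eqP (iP l)) sgb_sqr.
  apply: (@mean_odd _ _ (l0, i l0)) => e.
  have l0r : l0 != rep (P l0) by apply: contraNneq il0 => <-.
  rewrite /G (bigD1 l0)//= [in RHS](bigD1 l0)//= -mulNr; congr (_ * _).
    by rewrite !ffunE !xpair_eqE !eqxx/= eq_sym (negbTE il0) sgbN mulrN.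
  by apply: eq_bigr => l /andP[_ ll0]; rewrite !ffunE !xpair_eqE (negbTE ll0).
suff <- : mean (fun e => signform a (t e)) =
    signform (fun j : {ffun W -> V} => a [ffun l => j (P l)]) s.
  rewrite ler_norml -[X in _ && (_ <= X)](@mean_cst _ (U * V)%type).
  rewrite -[X in X <= _](@mean_cst _ (U * V)%type).
  by rewrite !ler_mean// => e; have := aL (t e); rewrite ler_norml => /andP[].
rewrite /signform mean_sum.
under eq_bigr => i _.
  rewrite (@eq_mean _ _ _ (fun e => a i * (\prod_k sgb R (s k (i (rep k)))) * G i e)).
    rewrite meanZ G1 mulr_natr; over.
  by move=> e; rewrite tE mulrA.
rewrite (bigID (fun i : {ffun U -> V} => [forall l, i l == i (rep (P l))]))/=.
rewrite [X in _ + X]big1 ?addr0; last by move=> i /negbTE ->; rewrite mulr0n.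
(* Indices constant on the fibres are the [j o P], and composition with [rep] recovers [j]. *)
rewrite (reindex_onto (fun j : {ffun W -> V} => [ffun l => j (P l)])
  (fun i : {ffun U -> V} => [ffun k => i (rep k)]))/=; last first.
  by move=> i /forallP iP; apply/ffunP => l; rewrite !ffunE; exact/esym/eqP.
apply: eq_big => j.
  rewrite (_ : [forall l, _]) /=; last by apply/forallP => l; rewrite !ffunE repK.
  by apply/eqP/ffunP => k; rewrite !ffunE repK.
move=> /andP[-> _]; rewrite mulr1n; congr (_ * _); apply: eq_bigr => k _.
by rewrite ffunE repK.
Qed.

(** * Slice norms and the arithmetic-geometric mean inequality *)

Section slices.
Variables (R : realType) (W V : finType) (b : {ffun W -> V} -> R).

(** For [b j = a (j o P)] this is the number [alpha_(P,k)(v)]. *)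
Definition slice_norm (k : W) (v : V) : R :=
  Num.sqrt (\sum_(j : {ffun W -> V} | j k == v) b j ^+ 2).

Lemma ler_slice_norm (j : {ffun W -> V}) k : `|b j| <= slice_norm k (j k).
Proof.
rewrite -sqrtr_sqr; apply: ler_wsqrtr; rewrite (bigD1 j)//= lerDl.
by apply: sumr_ge0 => j' _; rewrite sqr_ge0.
Qed.

Lemma slice_norm_ge0 k v : 0 <= slice_norm k v.
Proof. exact: sqrtr_ge0. Qed.

(** The first [M + 1] terms of the arithmetic-geometric mean inequality, without the factor [A]. *)
Definition slice_weight (j : {ffun W -> V}) : R :=
  \sum_k b j ^+ 2 / slice_norm k (j k) + \prod_k slice_norm k (j k).

Lemma slice_weight_ge0 j : 0 <= slice_weight j.
Proof.
apply: addr_ge0; last by apply: prodr_ge0 => k _; exact: slice_norm_ge0.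
by apply: sumr_ge0 => k _; rewrite divr_ge0 ?sqr_ge0 ?slice_norm_ge0.
Qed.

(** Over the slice [j k = v] the squares sum to the square of the slice norm, so each quotient sum
    returns the slice norm. The sum of the products factors over [k]. *)
Lemma sum_slice_weight (c : R) : (forall k, \sum_v slice_norm k v <= c) ->
  \sum_j slice_weight j <= #|W|%:R * c + c ^+ #|W|.
Proof.
move=> bc; rewrite big_split/=; apply: lerD.
  rewrite exchange_big mulr_natl -sumr_const; apply: ler_sum => k _.
  apply: le_trans (bc k).
  rewrite (partition_big (fun j : {ffun W -> V} => j k) xpredT)//=.
  apply: ler_sum => v _.
  rewrite (eq_bigr (fun j => b j ^+ 2 / slice_norm k v)); last by move=> j /eqP ->.
  rewrite -mulr_suml -[X in X / _]sqr_sqrtr; last first.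
    by apply: sumr_ge0 => j _; rewrite sqr_ge0.
  rewrite -/(slice_norm k v) expr2.
  (* A zero slice contributes 0, as division by zero yields 0. *)
  have [->|nz] := eqVneq (slice_norm k v) 0; first by rewrite mulr0 mul0r.
  by rewrite mulfK.
rewrite -(bigA_distr_bigA slice_norm) -prodr_const; apply: ler_prod => k _.
by rewrite bc sumr_ge0// => v _; exact: slice_norm_ge0.
Qed.
End slices.

Section amgm.
Variable R : realType.

(** The relation between [A] and [B] makes the product of the [m + 1] terms equal to [x^(2m)],
    because the [al k] cancel. *)
Lemma powR_le_amgm (M m : nat) (x A B : R) (al : 'I_M -> R) :
  (0 < m)%N -> (M <= m)%N -> 0 <= x -> 0 <= A -> 0 <= B -> A ^+ M.+1 * B ^+ (m - M) = 1 ->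
  (forall k, x <= al k) ->
  x `^ ((2 * m)%:R / m.+1%:R) <=
  (A * (\sum_k x ^+ 2 / al k + \prod_k al k) + (m - M)%:R * (B * x ^+ 2)) / m.+1%:R.
Proof.
move=> m0 Mm x0 A0 B0 AB xal.
have al0 k : 0 <= al k by exact: le_trans (xal k).
(* The cancellation needs [al k <> 0], which [x <= al k] ensures only for [x > 0]. *)
have [x00|xN0] := eqVneq x 0.
  rewrite x00 powR0; last by rewrite mulf_neq0// ?invr_eq0// pnatr_eq0// muln_eq0 -lt0n m0.
  rewrite divr_ge0//; apply: addr_ge0; apply: mulr_ge0 => //; last first.
    by rewrite mulr_ge0 ?sqr_ge0.
  apply: addr_ge0; last exact: prodr_ge0.
  by apply: sumr_ge0 => k _; rewrite divr_ge0 ?sqr_ge0.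
(* The sum type indexes the three groups of terms, of sizes [1], [M] and [m - M]. *)
pose E (t : 'I_1 + ('I_M + 'I_(m - M))) : R := match t with
  | inl _ => A * \prod_k al k
  | inr (inl k) => A * (x ^+ 2 / al k)
  | inr (inr _) => B * x ^+ 2 end.
have E0 t : 0 <= E t.
  case: t => [u|[k|u]]; apply: mulr_ge0 => //.
  - by apply: prodr_ge0.
  - by rewrite divr_ge0 ?sqr_ge0.
  - by rewrite sqr_ge0.
have := leif_AGM (A := predT) (fun t (_ : t \in predT) => E0 t).
have -> : #|{: 'I_1 + ('I_M + 'I_(m - M))}| = m.+1.
  by rewrite !card_sum !card_ord subnKC.
move=> [/= + _]; rewrite !big_sumType/= !big_ord1 big_split/=.
rewrite !prodr_const sumr_const !card_ord -mulr_sumr.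
set S := (X in _ -> _ <= X) => prod_le.
have prodE : \prod_(k < M) (x ^+ 2 / al k) * \prod_(k < M) al k = x ^+ (2 * M).
  rewrite -big_split/= (eq_bigr (fun=> x ^+ 2)) => [|k _].
    by rewrite prodr_const card_ord exprM.
  rewrite mulfVK// gt_eqF//; apply: lt_le_trans (xal k).
  by rewrite lt_def xN0.
have {}prod_le : x ^+ (2 * m) <= S ^+ m.+1.
  have SE : S = (A * \prod_k al k + (A * (\sum_k x ^+ 2 / al k) +
      B * x ^+ 2 *+ (m - M))) / m.+1%:R.
    by rewrite /S mulr_natl; congr (_ / _); ring.
  rewrite SE; apply: le_trans prod_le; rewrite le_eqVlt; apply/orP; left.
  rewrite exprMn; move: AB prodE.
  rewrite (_ : (2 * m = 2 * M + 2 * (m - M))%N); last by rewrite -mulnDr subnKC.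
  rewrite exprD -!exprM exprS; move: (\prod_k _) (\prod_k _) => p q AB pE.
  by rewrite -pE -[X in X * _ == _]mul1r -AB; apply/eqP; ring.
have S0 : 0 <= S.
  rewrite divr_ge0//; apply: addr_ge0; apply: mulr_ge0 => //; last first.
    by rewrite mulr_ge0 ?sqr_ge0.
  apply: addr_ge0; last exact: prodr_ge0.
  by apply: sumr_ge0 => k _; rewrite divr_ge0 ?sqr_ge0.
rewrite -(@ler_pXn2r _ m.+1) ?nnegrE ?powR_ge0//.
rewrite -powR_mulrn ?powR_ge0// -powRrM mulfVK ?pnatr_eq0//.
by rewrite powR_mulrn.
Qed.
End amgm.

(* [c] is the constant of [sign_bounded_mixed] for [M] variables. *)
Definition BH_bound (R : realType) (m M : nat) : R :=
  let c := 2 * 3 ^+ M in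
  (M%:R ^+ M * (M%:R * c + c ^+ M) + (m - M)%:R * M%:R ^+ M.+1) / m.+1%:R.

(** * Summation over finitely many indices with few values *)

Section few_sums.
Variables (R : realType) (M m : nat) (V : finType).
Hypotheses (M_gt0 : (0 < M)%N) (Mm : (M <= m)%N).
Variable D : pred {ffun 'I_m -> V}.
Hypothesis DP : forall i, D i -> exists2 P : {ffun 'I_m -> 'I_M},
  (forall k, exists l, P l = k) & exists j : {ffun 'I_M -> V}, i = [ffun l => j (P l)].
Local Notation p := ((2 * m)%:R / m.+1%:R : R).

Lemma sign_bounded_few1 (a : {ffun 'I_m -> V} -> R) : sign_bounded a 1 ->
  \sum_(i | D i) `|a i| `^ p <= BH_bound R m M.
Proof.
move=> a1; have m0 : (0 < m)%N by exact: leq_trans M_gt0 Mm.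
have MR0 : 0 < M%:R :> R by rewrite ltr0n.
(* Both [A^(M+1) B^(m-M) = 1] and [A M^m = M^M] hold; the second pays for the number of maps [P]. *)
pose A : R := M%:R ^+ M / M%:R ^+ m; pose B : R := M%:R ^+ M.+1.
have A0 : 0 <= A by rewrite divr_ge0 ?exprn_ge0.
have B0 : 0 <= B by rewrite exprn_ge0.
have AB : A ^+ M.+1 * B ^+ (m - M) = 1.
  rewrite /A /B expr_div_n -!exprM mulnC [(m * _)%N]mulnC.
  rewrite mulrAC -exprD -mulnDr subnKC// divff// expf_neq0// gt_eqF//.
pose c : R := 2 * 3 ^+ M.
pose onto (P : {ffun 'I_m -> 'I_M}) := [forall k, exists l, P l == k].
pose b (P : {ffun 'I_m -> 'I_M}) (j : {ffun 'I_M -> V}) := a [ffun l => j (P l)].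
(* [H i] adds up the weights of all factorisations [i = j o P]. One of them suffices for the
   pointwise bound, and the total over [i] is found by exchanging sums. *)
pose H (i : {ffun 'I_m -> V}) := \sum_(P | onto P)
  \sum_(j : {ffun 'I_M -> V}) (i == [ffun l => j (P l)])%:R * slice_weight (b P) j.
have H0 i : 0 <= H i.
  apply: sumr_ge0 => P _; apply: sumr_ge0 => j _.
  by rewrite mulr_ge0 ?slice_weight_ge0.
have point i : D i -> `|a i| `^ p <=
    (A * H i + (m - M)%:R * (B * a i ^+ 2)) / m.+1%:R.
  move=> /DP[P Ponto [j iE]].
  have xal k : `|a i| <= slice_norm (b P) k (j k).
    by have := ler_slice_norm (b P) j k; rewrite /b -iE.
  apply: le_trans (powR_le_amgm m0 Mm (normr_ge0 _) A0 B0 AB xal) _.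
  apply: ler_wpM2r; rewrite ?invr_ge0// real_normK ?num_real// lerD2r.
  apply: ler_wpM2l => //.
  have oP : onto P by apply/forallP => k; have [l <-] := Ponto k; apply/existsP; exists l.
  rewrite /H (bigD1 P)//= (bigD1 j)//= -iE eqxx mul1r /slice_weight.
  rewrite -addrA.
  have -> : b P j = a i by rewrite /b -iE.
  rewrite lerDl addr_ge0//; last first.
    apply: sumr_ge0 => P' _; apply: sumr_ge0 => j' _.
    by rewrite mulr_ge0 ?slice_weight_ge0.
  by apply: sumr_ge0 => j' _; rewrite mulr_ge0 ?slice_weight_ge0.
apply: le_trans (ler_sum _ point) _.
rewrite -mulr_suml /BH_bound -/c; apply: ler_wpM2r; rewrite ?invr_ge0//.
rewrite big_split/= -!mulr_sumr; apply: lerD.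
  have sumH : \sum_(i | D i) H i <= M%:R ^+ m * (M%:R * c + c ^+ M).
    apply: (@le_trans _ _ (\sum_i H i)).
      by rewrite [leRHS](bigID D)/= lerDl sumr_ge0.
    rewrite /H exchange_big/=.
    apply: (@le_trans _ _ (\sum_(P | onto P) (M%:R * c + c ^+ M))); last first.
      (* Counting all maps in place of the maps onto is enough. *)
      have cardP : (#|onto| <= M ^ m)%N.
        have -> : (M ^ m)%N = #|{: {ffun 'I_m -> 'I_M}}| by rewrite card_ffun !card_ord.
        exact: max_card.
      rewrite sumr_const -[_ *+ #|_|]mulr_natl -natrX; apply: ler_wpM2r.
        by rewrite addr_ge0 ?exprn_ge0 ?mulr_ge0 ?exprn_ge0.
      by rewrite ler_nat.
    apply: ler_sum => P /forallP Ponto; rewrite exchange_big/=.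
    rewrite (eq_bigr (slice_weight (b P))) => [|j _]; last first.
      rewrite -mulr_suml (bigD1 [ffun l => j (P l)])//= eqxx big1 ?addr0 ?mul1r//.
      by move=> i /negbTE ->.
    suff bc k : \sum_v slice_norm (b P) k v <= c.
      by have := sum_slice_weight bc; rewrite card_ord.
    have Pon k' : exists l, P l = k' by have /existsP[l /eqP] := Ponto k'; exists l.
    have := sign_bounded_mixed k (sign_bounded_comp Pon a1).
    by rewrite card_ord mulr1.
  apply: le_trans (ler_wpM2l A0 sumH) _.
  by rewrite /A mulrA divfK// expf_neq0// gt_eqF.
rewrite ler_wpM2l// -[leRHS]mulr1 ler_wpM2l//.
rewrite -[leRHS](expr1n _ 2); apply: le_trans (sign_bounded_l2 a1).
by rewrite [leRHS](bigID D)/= lerDl sumr_ge0// => i _; rewrite sqr_ge0.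
Qed.

(** Homogeneity reduces to [L = 1]; for [L = 0] Parseval forces all coefficients to vanish. *)
Lemma sign_bounded_few (a : {ffun 'I_m -> V} -> R) L : sign_bounded a L ->
  \sum_(i | D i) `|a i| `^ p <= BH_bound R m M * L `^ p.
Proof.
move=> aL; have L0 := sign_bounded_ge0 aL.
have m0 : (0 < m)%N by exact: leq_trans M_gt0 Mm.
have p0 : p != 0.
  by rewrite mulf_neq0// ?invr_eq0// pnatr_eq0// muln_eq0 -lt0n m0.
have [L00|LN0] := eqVneq L 0.
  rewrite L00 powR0// mulr0 big1// => i _.
  suff -> : a i = 0 by rewrite normr0 powR0.
  have := sign_bounded_l2 aL; rewrite L00 expr0n/= => s0.
  apply/eqP; rewrite -sqrf_eq0 eq_le sqr_ge0 andbT; apply: le_trans s0.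
  by rewrite (bigD1 i)//= lerDl sumr_ge0// => j _; rewrite sqr_ge0.
have Lp : 0 < L by rewrite lt_def LN0.
have aL1 : sign_bounded (fun i => a i / L) 1.
  move=> s; rewrite (_ : signform _ s = signform a s / L).
    by rewrite normrM normfV (ger0_norm L0) ler_pdivrMr// mul1r.
  by rewrite /signform mulr_suml; apply: eq_bigr => i _; rewrite mulrAC.
have := sign_bounded_few1 aL1.
rewrite -(ler_pM2r (powR_gt0 p Lp)); apply: le_trans.
rewrite mulr_suml; apply: ler_sum => i _.
rewrite -powRM// normrM normfV (ger0_norm L0) divfK//.
Qed.
End few_sums.

(** * Multilinear forms on c_0 *)

(** The product topology is the supremum of the topologies induced by the coordinates. *)
Lemma ptws_cvg (I : eqType) (V : topologicalType) (F : set_system {ptws I -> V})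
    (f : {ptws I -> V}) :
  Filter F -> (forall i, g i @[g --> F] --> f i) -> F --> f.
Proof.
move=> FF cF; apply/cvg_sup => i W.
rewrite nbhsE; case=> O [[B oB <-] Bt] OW.
apply: filterS OW _; apply: (cF i B).
exact: open_nbhs_nbhs.
Qed.

Section c0_forms.
Variables (K : numFieldType) (m : nat) (T : ('I_m -> c0 K) -> K).
Hypothesis mT : multilinear_form T.

Lemma multilinear_sum (k : 'I_m) (x : 'I_m -> c0 K) (J : Type) (r : seq J)
    (c : J -> K) (u : J -> c0 K) :
  T (dfwith x k (\sum_(j <- r) c j *: u j)) =
  \sum_(j <- r) c j * T (dfwith x k (u j)).
Proof.
have lin := mT k x.
have T0 : T (dfwith x k 0) = 0.
  have := lin 1 0 0; rewrite scaler0 addr0 mul1r.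
  by move=> /eqP; rewrite -subr_eq subrr eq_sym => /eqP.
elim: r => [|j r IH]; first by rewrite !big_nil.
by rewrite !big_cons lin IH.
Qed.

Lemma multilinear_scale (c : K) (x : 'I_m -> c0 K) :
  T (fun l => c *: x l) = c ^+ m * T x.
Proof.
(* The variables are scaled one after the other; [y k] has the first [k] of them scaled. *)
pose y k (l : 'I_m) : c0 K := if (l < k)%N then c *: x l else x l.
suff yk k : (k <= m)%N -> T (y k) = c ^+ k * T x.
  by rewrite -yk//; congr T; apply/funext => l; rewrite /y ltn_ord.
elim: k => [_|k IH km]; first by rewrite expr0 mul1r.
rewrite exprS -mulrA -IH 1?ltnW//.
have -> : y k.+1 = dfwith (y k) (Ordinal km) (\sum_(j <- [:: tt]) c *: x (Ordinal km)).
  apply/funext => l; rewrite big_seq1; have [<-|kl] := eqVneq (Ordinal km) l.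
    by rewrite dfwithin /y ltnSn.
  rewrite dfwithout// /y ltnS leq_eqVlt; case: eqP => // lk.
  by case/eqP: kl; apply/val_inj.
rewrite multilinear_sum big_seq1; congr (_ * T _); apply/funext => l.
have [<-|kl] := eqVneq (Ordinal km) l; last by rewrite dfwithout.
by rewrite dfwithin /y ltnn.
Qed.

(* The variables are expanded one at a time: [y k i] has the first [k] variables
   replaced by unit vectors, and [i] is normalised to 0 from [k] on. *)
Lemma multilinear_expand n (e : 'I_m -> 'I_n.+1 -> K) :
  T (fun l => \sum_v e l v *: unitv K v) =
  \sum_(i : {ffun 'I_m -> 'I_n.+1}) (\prod_l e l (i l)) * T (fun l => unitv K (i l)).
Proof.
pose x l := \sum_v e l v *: unitv K (nat_of_ord v).
pose y k (i : {ffun 'I_m -> 'I_n.+1}) (l : 'I_m) :=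
  if (l < k)%N then unitv K (i l) else x l.
pose D k (i : {ffun 'I_m -> 'I_n.+1}) := [forall l : 'I_m, (k <= l)%N ==> (i l == ord0)].
pose S k := \sum_(i | D k i) (\prod_(l : 'I_m | (l < k)%N) e l (i l)) * T (y k i).
suff Sk k : (k <= m)%N -> S k = T x.
  rewrite -[LHS](Sk m)//; apply: eq_big => [i|i _].
    by apply/forallP => l; rewrite leqNgt ltn_ord.
  rewrite [X in X * _ = _](eq_bigl xpredT) => [|l]; last exact: ltn_ord.
  by congr (_ * T _); apply/funext => l; rewrite /y ltn_ord.
elim: k => [_|k IH km].
  rewrite /S (big_pred1 [ffun=> ord0]) => [|i].
    by rewrite big_pred0// mul1r.
  apply/forallP/eqP => [i0|->] => [|l]; last by rewrite ffunE.
  by apply/ffunP => l; rewrite ffunE; apply/eqP/(i0 l).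
rewrite -IH 1?ltnW// /S.
pose o := Ordinal km.
pose upd (i : {ffun 'I_m -> 'I_n.+1}) v : {ffun 'I_m -> 'I_n.+1} :=
  [ffun l => if l == o then v else i l].
have lo (l : 'I_m) : l != o -> (l < k.+1)%N = (l < k)%N.
  move=> lo'; rewrite ltnS leq_eqVlt; case: eqP => // lk.
  by case/eqP: lo'; apply/val_inj.
transitivity (\sum_(i | D k i) \sum_v
   (\prod_(l : 'I_m | (l < k.+1)%N) e l (upd i v l)) * T (y k.+1 (upd i v))).
  (* An index normalised from [k + 1] on amounts to one normalised from [k] on together with its
     value at position [k]. *)
  rewrite pair_big/= (reindex_onto (fun i => (upd i ord0, i o)) (fun p => upd p.1 p.2))/=.
    apply: eq_big => [i|i _].
      rewrite andbT; apply/idP/andP.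
        move=> /forallP Di; split; last first.
          by apply/eqP/ffunP => l; rewrite !ffunE; case: eqP => [->|].
        apply/forallP => l; rewrite ffunE; have [_|lo'] := eqVneq l o.
          by rewrite eqxx implybT.
        apply/implyP => kl; have /implyP := Di l; apply.
        rewrite ltn_neqAle kl andbT; apply: contraNneq lo' => kl'.
        exact/eqP/val_inj/esym.
      move=> [/forallP Di _]; apply/forallP => l; apply/implyP => kl.
      have := Di l; rewrite (ltnW kl)/= ffunE; have [lo'|//] := eqVneq l o.
      by move: kl; rewrite lo' ltnn.
    have -> : upd (upd i ord0) (i o) = i.
      by apply/ffunP => l; rewrite !ffunE; case: eqP => [->|].
    by [].
  move=> [i v]/= /andP[/forallP Di _]; congr pair.
    apply/ffunP => l; rewrite !ffunE; case: eqP => // ->.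
    by have /implyP/(_ (leqnn _))/eqP := Di o.
  by rewrite !ffunE eqxx.
apply: eq_bigr => i _.
have -> : y k i = dfwith (y k i) o (\sum_v e o v *: unitv K v).
  apply/funext => l; have [<-|kl] := eqVneq o l; last by rewrite dfwithout.
  by rewrite dfwithin /y ltnn.
rewrite multilinear_sum mulr_sumr; apply: eq_bigr => v _.
rewrite (bigD1 o)//= ffunE eqxx mulrA [e o v * _]mulrC; congr (_ * _ * T _).
  apply: eq_big => [l|l /andP[_ lo']]; last by rewrite ffunE (negbTE lo').
  have [->|lo'] := eqVneq l o; first by rewrite andbF ltnn.
  by rewrite andbT lo.
apply/funext => l; rewrite /y.
have [<-|ol] := eqVneq o l; first by rewrite dfwithin ltnSn ffunE eqxx.
by rewrite dfwithout// lo 1?eq_sym// ffunE eq_sym (negbTE ol).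
Qed.

End c0_forms.

Section c0_coordinates.
Variable K : numFieldType.

Lemma c0_coordD (x y : c0 K) n : (x + y) n = x n + y n.
Proof. by []. Qed.

Lemma c0_coordZ (a : K) (x : c0 K) n : (a *: x) n = a * x n.
Proof. by []. Qed.

Lemma c0_coord0 n : (0 : c0 K) n = 0.
Proof. by []. Qed.

Lemma c0_coord_sum n (e : 'I_n -> K) k :
  (\sum_v e v *: unitv K v) k = if insub k is Some v then e v else 0.
Proof.
rewrite (big_morph (fun x : c0 K => x k) (fun x y => c0_coordD x y k) (c0_coord0 k)).
rewrite (eq_bigr (fun v : 'I_n => e v * (k == v)%:R)) => [|v _ //].
case: insubP => [v _ vk|kn].
  rewrite (bigD1 v)//= -[in X in X + _]vk eqxx mulr1 big1 ?addr0 // => w wv.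
  by rewrite -vk (inj_eq val_inj) eq_sym (negbTE wv) mulr0.
rewrite big1// => v _; rewrite (_ : _ == _ = false) ?mulr0//.
by apply: contraNF kn => /eqP ->.
Qed.

Lemma norm_c0E (x : c0 K) : `|x| = c0_norm x.
Proof. by []. Qed.

Lemma le_coord_norm (x : c0 K) n : `|x n| <= `|x|.
Proof. by rewrite norm_c0E; have [n0 -> ] := c0_normP x. Qed.

Lemma norm_sign_vector n (e : 'I_n.+1 -> bool) :
  `|\sum_v (-1) ^+ e v *: unitv K v| = 1 :> K.
Proof.
apply/le_anti/andP; split.
  rewrite norm_c0E; have [n0 -> _] := c0_normP (\sum_v (-1) ^+ e v *: unitv K v).
  rewrite c0_coord_sum; case: insubP => [v _ _|_]; last by rewrite normr0.
  by rewrite normrX normrN1 expr1n.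
apply: le_trans (le_coord_norm _ 0); rewrite c0_coord_sum.
by case: insubP => [v _ _|//]; rewrite normrX normrN1 expr1n.
Qed.

(** Makes the [sup] in [form_norm] meaningful. Continuity at 0 gives [|T| < 1] where all norms are
    at most [d], and homogeneity turns this into the bound [d^-m]. *)
Lemma continuous_form_bounded m (T : {ptws 'I_m -> c0 K} -> K) :
  (0 < m)%N -> multilinear_form T -> continuous T ->
  exists B : K, forall x, (forall l, `|x l| = 1) -> `|T x| <= B.
Proof.
move=> m0 mT cT.
(* The filter of the products of small balls, which tends to 0 in the product topology. *)
pose F : set_system {ptws 'I_m -> c0 K} :=
  filter_from [set d : K | 0 < d] (fun d => [set x | forall l, `|x l| <= d]).
have FF : Filter F.
  apply: filter_from_filter; first by exists 1; exact: ltr01.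
  move=> d e d0 e0; have [de|ed] := real_leP (gtr0_real d0) (gtr0_real e0).
    by exists d => // x xd; split => // l; apply: le_trans (xd l) de.
  by exists e => // x xd; split => // l; apply: le_trans (xd l) (ltW ed).
pose z : {ptws 'I_m -> c0 K} := fun=> 0.
have F0 : F --> z.
  apply: ptws_cvg => l; apply/cvgr0Pnorm_lt => e e0.
  exists (e / 2); first by rewrite /= divr_gt0.
  move=> x /(_ l) xl /=; apply: le_lt_trans xl _.
  by rewrite ltr_pdivrMr// ltr_pMr// ltr1n.
have T0 : T z = 0.
  have := multilinear_scale mT 0 z; rewrite expr0n (gtn_eqF m0) mul0r => <-.
  by congr T; apply/funext => l; rewrite scaler0.
have := cvg_trans (cvg_app T F0) (cT z).
rewrite T0 => /cvgr0Pnorm_lt/(_ 1 ltr01)[d d0 dT].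
exists (d ^- m) => x x1.
have := dT (fun l => d *: x l).
rewrite /= multilinear_scale// normrM normrX (gtr0_norm d0) => H.
rewrite -[leRHS]mul1r ler_pdivlMr ?exprn_gt0// mulrC ltW// H// => l.
by rewrite normrZ x1 mulr1 gtr0_norm.
Qed.
End c0_coordinates.

(** * Factoring index tuples through maps onto ['I_M] *)

(* Move one of two points with the same value to a missed value, and iterate. *)
Lemma onto_refine (M m : nat) (P0 : {ffun 'I_m -> 'I_M}) : (M <= m)%N ->
  exists2 P : {ffun 'I_m -> 'I_M}, (forall k, exists l, P l = k) &
    exists h : 'I_M -> 'I_M, forall l, P0 l = h (P l).
Proof.
move=> Mm; have [d] := ubnP (M - #|codom P0|)%N.
elim: d P0 => // d IH P0; rewrite ltnS => Pd.
have [/forallP P0onto|/forallPn[k k0]] := boolP [forall k, k \in codom P0].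
  exists P0; last by exists id.
  by move=> k; have /codomP[l ->] := P0onto k; exists l.
have cP0 : (#|codom P0| < M)%N.
  rewrite -[ltnRHS]card_ord; apply: proper_card; apply/properP; split.
    exact/fintype.subsetP.
  by exists k.
(* An injective [P0] would have [m >= M] values, but it misses [k]. *)
have /injectivePn[l [l' ll' Pll']] : ~~ injectiveb P0.
  apply/negP => /injectiveP/card_codom; rewrite card_ord => e.
  by move: cP0; rewrite e ltnNge Mm.
pose P1 : {ffun 'I_m -> 'I_M} := [ffun x => if x == l then k else P0 x].
have [|P Ponto [h hP]] := IH P1.
  apply: leq_trans Pd; apply: ltn_sub2l => //.
  apply: (@leq_trans #|[predU1 k & codom P0]|).
    by rewrite cardU1 k0.
  apply: subset_leq_card; apply/fintype.subsetP => v.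
  rewrite inE => /predU1P[->|/codomP[x ->]].
    by apply/codomP; exists l; rewrite ffunE eqxx.
  have [->|xl] := eqVneq x l.
    by apply/codomP; exists l'; rewrite ffunE eq_sym (negbTE ll').
  by apply/codomP; exists x; rewrite ffunE (negbTE xl).
(* [P1] takes the value [k] only at [l], so sending [k] back to [P0 l] recovers [P0]. *)
exists P => //; exists (fun v => if h v == k then P0 l else h v) => x.
rewrite -hP ffunE; have [->|xl] := eqVneq x l; first by rewrite eqxx.
case: eqP => // xk; case/negP: k0; apply/codomP; exists x.
by rewrite xk.
Qed.

(** An injection of the range of [i] into [M] values gives a map [P0], which is then refined to be
    onto. *)
Lemma few_factor (M m : nat) (i : {ffun 'I_m -> nat}) :
  (0 < M)%N -> (M <= m)%N -> few_indices M i ->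
  exists2 P : {ffun 'I_m -> 'I_M}, (forall k, exists l, P l = k) &
    exists j : 'I_M -> nat, forall l, i l = j (P l).
Proof.
case: M => // M _ Mm /pcard_leP[f].
have fM l : (f (i l) < M.+1)%N by apply: (funS (s := f) (i l)); exists l.
pose P0 : {ffun 'I_m -> 'I_M.+1} := [ffun l => Ordinal (fM l)].
have [P Ponto [h hP]] := onto_refine P0 Mm.
exists P => //.
(* [g] inverts the injection on the range of [i]; values not attained get the default 0. *)
pose g (v : 'I_M.+1) := if [pick l | P0 l == v] is Some l then i l else 0%N.
exists (g \o h) => l; rewrite /= -hP /g; case: pickP => [l' /eqP|/(_ l)].
  rewrite !ffunE => -[e]; have fe : f (i l) = f (i l') by exact/esym.
  by apply: (inj (f := f)) fe; rewrite inE; [exists l|exists l'].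
by rewrite eqxx.
Qed.

Section few_sequences.
Variables (R : realType) (M m : nat).
Hypotheses (M_gt0 : (0 < M)%N) (Mm : (M <= m)%N).
Local Notation p := ((2 * m)%:R / m.+1%:R : R).

(** Finitely many tuples have all entries below some [n + 1], so the bound for finite arrays
    applies. *)
Lemma few_seq_bound (a : ('I_m -> nat) -> R) (L : R) :
  (forall n, sign_bounded (fun i : {ffun 'I_m -> 'I_n.+1} => a (fun l => i l)) L) ->
  forall r : seq {ffun 'I_m -> nat}, uniq r -> {in r, forall i, few_indices M i} ->
  \sum_(i <- r) `|a i| `^ p <= BH_bound R m M * L `^ p.
Proof.
move=> aL r ur rfew.
pose n := \max_(i <- r) \max_l (i : {ffun 'I_m -> nat}) l.
have rn i l : i \in r -> (i l <= n)%N.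
  move=> ir; apply: (@leq_trans (\max_l i l)); first exact: leq_bigmax.
  exact: (@leq_bigmax_seq _ r xpredT (fun i : {ffun 'I_m -> nat} => \max_l i l)%N).
pose o (i : {ffun 'I_m -> nat}) : {ffun 'I_m -> 'I_n.+1} := [ffun l => inord (i l)].
have oK i : i \in r -> (fun l => (o i) l : nat) = i.
  by move=> ir; apply/funext => l; rewrite ffunE inordK// ltnS rn.
have oinj : {in r &, injective o}.
  move=> i i' ir ir' e; apply/ffunP => l.
  by rewrite -[LHS](congr1 (fun f => f l) (oK i ir)) e (congr1 (fun f => f l) (oK i' ir')).
have uo : uniq (map o r) by rewrite map_inj_in_uniq.
pose D (i : {ffun 'I_m -> 'I_n.+1}) := i \in map o r.
have DP i : D i -> exists2 P : {ffun 'I_m -> 'I_M},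
    (forall k, exists l, P l = k) & exists j : {ffun 'I_M -> 'I_n.+1}, i = [ffun l => j (P l)].
  move=> /mapP[i' i'r ->].
  have [P Ponto [j jP]] := few_factor M_gt0 Mm (rfew _ i'r).
  exists P => //; exists [ffun k => inord (j k)].
  by apply/ffunP => l; rewrite !ffunE jP.
apply: le_trans (sign_bounded_few M_gt0 Mm DP (aL n)).
rewrite -(big_uniq _ uo)/= big_map big_seq [leRHS]big_seq.
by apply: ler_sum => i ir; rewrite oK.
Qed.

Lemma esum_le_seq (I : choiceType) (D : set I) (f : I -> R) (B : R) :
  (forall r : seq I, uniq r -> {in r, forall i, D i} -> \sum_(i <- r) f i <= B) ->
  (\esum_(i in D) (f i)%:E <= B%:E)%E.
Proof.
move=> fB; apply: ge_ereal_sup => _ [X [finX XD] <-].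
rewrite fsbig_finite// sumEFin lee_fin; apply: fB => // i.
by rewrite in_fset_set// inE; exact: XD.
Qed.
End few_sequences.

(** * Upper bounds for real and complex forms *)

Lemma normr_bounded (R : realType) (B : R) :
  exists B' : R, forall z : R, `|z| <= B -> `|z| <= B'.
Proof. by exists B. Qed.

(** In the order of [R[i]], [z <= w] compares real parts and requires equal imaginary parts, so the
    real part of [B] is a bound. *)
Lemma normc_bounded (R : realType) (B : R[i]) :
  exists B' : R, forall z : R[i], `|z| <= B -> Normc.normc z <= B'.
Proof.
exists (complex.Re B) => z; rewrite normc_def; case: B => a b.
by rewrite lecE/= => /andP[_]; case: z.
Qed.

Section forms_over_K.
Variables (R : realType) (K : numFieldType) (abs : K -> R).
Hypothesis absB : forall B : K, exists B' : R, forall z, `|z| <= B -> abs z <= B'.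
Variables (m : nat) (T : {ptws 'I_m -> c0 K} -> K).
Hypotheses (m0 : (0 < m)%N) (mT : multilinear_form T) (cT : continuous T).

Lemma abs_le_form_norm x : (forall l, `|x l| = 1) -> abs (T x) <= form_norm abs T.
Proof.
move=> x1; apply: ub_le_sup; last by exists x.
have [B TB] := continuous_form_bounded m0 mT cT.
have [B' zB'] := absB B; exists B' => _ [y y1 <-].
by apply: zB'; exact: TB.
Qed.

(** [rho] stands for the identity, the real part or the imaginary part. Only signs multiply the
    coefficients of [T] at sign vectors, so additivity lets [rho] pass to each coefficient. *)
Lemma sign_bounded_form (rho : K -> R) :
  {morph rho : z w / z + w} -> (forall z, `|rho z| <= abs z) ->
  forall n, sign_bounded (fun i : {ffun 'I_m -> 'I_n.+1} =>
     rho (T (fun l => unitv K (i l)))) (form_norm abs T).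
Proof.
move=> rhoD rhoabs n s.
have rho0 : rho 0 = 0.
  by apply: (addrI (rho 0)); rewrite -rhoD !addr0.
have rhoN z : rho (- z) = - rho z.
  by apply/eqP; rewrite -addr_eq0 -rhoD addNr rho0.
have := abs_le_form_norm (fun l => norm_sign_vector K (s l)).
apply: le_trans; apply: le_trans (rhoabs _).
rewrite multilinear_expand// (big_morph rho rhoD rho0).
rewrite le_eqVlt; apply/orP; left; apply/eqP; congr `|_|.
apply: eq_bigr => i _; rewrite mulrC /sgb !prodrXr -2!(signr_odd _ (\sum_l _)).
by case: odd; rewrite ?expr1 ?expr0 ?mulN1r ?mul1r ?rhoN.
Qed.
End forms_over_K.

Lemma BH_bound_ge0 (R : realType) m M : 0 <= BH_bound R m M.
Proof.
by rewrite divr_ge0// addr_ge0// ?mulr_ge0 ?exprn_ge0.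
Qed.

Section restricted_BH_bounds.
Variables (R : realType) (M m : nat).
Hypotheses (M_gt0 : (0 < M)%N) (Mm : (M <= m)%N).
Local Notation p := ((2 * m)%:R / m.+1%:R : R).

Let m_gt0 : (0 < m)%N. Proof. exact: leq_trans M_gt0 Mm. Qed.

Lemma BH_exponent_gt0 : 0 < p.
Proof. by rewrite divr_gt0 ?ltr0n// muln_gt0. Qed.

Lemma BH_exponentV : m.+1%:R / (2 * m)%:R = p^-1.
Proof. by rewrite invf_div. Qed.

Lemma restricted_BH_intro (K : numFieldType) (abs : K -> R) (B : R) :
  0 <= B ->
  (forall T : {ptws 'I_m -> c0 K} -> K, multilinear_form T -> continuous T ->
     0 <= form_norm abs T /\
     (restricted_sum abs M T <= (B * form_norm abs T `^ p)%:E)%E) ->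
  restricted_BH abs m M (B `^ (m.+1%:R / (2 * m)%:R)).
Proof.
move=> B0 BT T mT cT; have [L0 sumT] := BT T mT cT.
have sum0 : (0 <= restricted_sum abs M T)%E.
  by apply: esum_ge0 => i _; rewrite lee_fin powR_ge0.
have p0 := BH_exponent_gt0.
apply: (@le_trans _ _ (poweR (B * form_norm abs T `^ p)%:E (m.+1%:R / (2 * m)%:R))).
  apply: gt0_ler_poweR => //.
  - by rewrite in_itv/= sum0 leey.
  - by rewrite in_itv/= leey andbT lee_fin mulr_ge0 ?powR_ge0.
rewrite poweR_EFin lee_fin powRM ?powR_ge0// BH_exponentV -powRrM divff ?gt_eqF//.
by rewrite powRr1.
Qed.

Lemma restricted_BH_real :
  restricted_BH (fun x : R => `|x|) m M (BH_bound R m M `^ (m.+1%:R / (2 * m)%:R)).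
Proof.
apply: restricted_BH_intro => [|T mT cT]; first exact: BH_bound_ge0.
have absB := @normr_bounded R.
have sT := sign_bounded_form absB m_gt0 mT cT (rho := id) (fun _ _ => erefl) (fun=> lexx _).
split; first exact: sign_bounded_ge0 (sT 0%N).
apply: esum_le_seq => r ur rD.
exact: (few_seq_bound M_gt0 Mm (a := fun i => T (fun l => unitv R (i l))) sT ur rD).
Qed.

Lemma restricted_BH_complex :
  restricted_BH (fun z : R[i] => Normc.normc z) m M
    ((2 `^ p * (2 * BH_bound R m M)) `^ (m.+1%:R / (2 * m)%:R)).
Proof.
apply: restricted_BH_intro => [|T mT cT].
  by rewrite !mulr_ge0 ?powR_ge0 ?BH_bound_ge0.
have absB := @normc_bounded R.
have ReN (z : R[i]) : `|complex.Re z| <= Normc.normc z.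
  case: z => a b /=; rewrite -sqrtr_sqr ler_wsqrtr// lerDl sqr_ge0//.
have ImN (z : R[i]) : `|complex.Im z| <= Normc.normc z.
  case: z => a b /=; rewrite -sqrtr_sqr ler_wsqrtr// lerDr sqr_ge0//.
have ReD : {morph @complex.Re R : z w / z + w} by case=> a b [c d].
have ImD : {morph @complex.Im R : z w / z + w} by case=> a b [c d].
have sRe := sign_bounded_form absB m_gt0 mT cT ReD ReN.
have sIm := sign_bounded_form absB m_gt0 mT cT ImD ImN.
split; first exact: sign_bounded_ge0 (sRe 0%N).
apply: esum_le_seq => r ur rD.
have p0 := ltW BH_exponent_gt0.
(* The real and imaginary parts are real arrays with the same sign bound; splitting the modulus
   costs the factors [2^p] and 2. *)
have normc_powR (z : R[i]) : Normc.normc z `^ p <=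
    2 `^ p * (`|complex.Re z| `^ p + `|complex.Im z| `^ p).
  have : Normc.normc z <= 2 * Num.max `|complex.Re z| `|complex.Im z|.
    apply: (@le_trans _ _ (`|complex.Re z| + `|complex.Im z|)).
      case: z => a b /=; rewrite -[leRHS]ger0_norm ?addr_ge0// -sqrtr_sqr.
      rewrite ler_wsqrtr// sqrrD -normrM !real_normK ?num_real//.
      by rewrite lerD2r lerDl mulrn_wge0.
    by rewrite mulr_natl mulr2n lerD// le_max lexx ?orbT.
  move=> /(ge0_ler_powR p0) H; apply: le_trans (H _ _) _; rewrite ?nnegrE.
  - by case: (z) => a b; exact: sqrtr_ge0.
  - by rewrite mulr_ge0// le_max normr_ge0.
  rewrite powRM ?le_max ?normr_ge0// ler_wpM2l ?powR_ge0//.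
  by rewrite /Num.max; case: ifP => _; rewrite ?lerDl ?lerDr powR_ge0.
apply: le_trans (ler_sum _ (fun i _ => normc_powR _)) _.
rewrite -mulr_sumr big_split/= -[leRHS]mulrA; apply: ler_wpM2l; first exact: powR_ge0.
rewrite -[leRHS]mulrA [leRHS]mulr_natl mulr2n; apply: lerD.
  exact: (few_seq_bound M_gt0 Mm
    (a := fun i => complex.Re (T (fun l => unitv R[i] (i l)))) sRe ur rD).
exact: (few_seq_bound M_gt0 Mm
  (a := fun i => complex.Im (T (fun l => unitv R[i] (i l)))) sIm ur rD).
Qed.
End restricted_BH_bounds.

(** * Lower bounds *)

Section address_form.
Variables (R : realType) (h d : nat) (code : 'I_d -> {ffun 'I_h -> bool} -> nat).
Local Notation m := (h + d)%N.

(** The last [d] variables act as an address: at the unit vectors given by the codes of [b] they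
    select the single term [b]. *)
Definition address_factor (b : {ffun 'I_h -> bool}) (l : 'I_m) (u : c0 R) : R :=
  match fintype.split l with
  | inl l' => u 0%N + (-1) ^+ b l' * u 1%N
  | inr r => u (code r b)
  end.

Definition address_form (x : 'I_m -> c0 R) : R :=
  \sum_(b : {ffun 'I_h -> bool}) \prod_l address_factor b l (x l).

Lemma address_factor_linear b l : linear_for *%R (address_factor b l).
Proof.
move=> a u v; rewrite /address_factor; case: fintype.split => [l'|r].
  by rewrite !c0_coordD !c0_coordZ; ring.
by rewrite c0_coordD c0_coordZ.
Qed.

Lemma multilinear_address_form : multilinear_form address_form.
Proof.
move=> k x a u v; rewrite /address_form mulr_sumr -big_split/=.
apply: eq_bigr => b _.
have off w : \prod_l address_factor b l (dfwith x k w l) =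
    address_factor b k w * \prod_(l | l != k) address_factor b l (x l).
  rewrite (bigD1 k)//= dfwithin; congr (_ * _).
  by apply: eq_bigr => l lk; rewrite dfwithout// eq_sym.
by rewrite !off address_factor_linear; ring.
Qed.

Lemma continuous_coord n : continuous (fun u : c0 R => u n).
Proof.
move=> u.
have FF : Filter (nbhs u) by exact: nbhs_filter.
apply/(@cvgrPdist_lt _ _ _ (nbhs u) FF) => e e0; near=> v.
rewrite -[_ - _]/((u - v) n); apply: le_lt_trans (le_coord_norm _ _) _.
near: v; apply/nbhs_normP; exists e.
Unshelve. all: by end_near. Qed.

Lemma continuous_address_form :
  continuous (address_form : {ptws 'I_m -> c0 R} -> R).
Proof.
apply: continuous_big => [|b _]; first exact: add_continuous.
apply: continuous_big => [|l _]; first exact: mul_continuous.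
have cl : continuous (fun x : {ptws 'I_m -> c0 R} => x l) by exact: proj_continuous.
have cn n : continuous (fun x : {ptws 'I_m -> c0 R} => x l n).
  move=> x; exact: (cvg_comp _ _ (cl x) (@continuous_coord n (x l))).
move=> x; rewrite /address_factor; case: fintype.split => [l'|r]; last exact: cn.
have FF : Filter (nbhs x) by exact: nbhs_filter.
exact: (cvgD (cn 0%N x) (cvgM (cvg_cst ((-1) ^+ b l' : R)) (cn 1%N x))).
Qed.

(** The address coordinates are at most 1 in modulus. The remaining sum over [b] factors into [h]
    sums [|u + v| + |u - v| <= 2]. *)
Lemma address_form_le (x : 'I_m -> c0 R) : (forall l, `|x l| = 1) -> `|address_form x| <= 2 ^+ h.
Proof.
move=> x1; have coord1 l n : `|x l n| <= 1 by rewrite -(x1 l) le_coord_norm.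
apply: le_trans (ler_norm_sum _ _ _) _.
pose f (l : 'I_h) (c : bool) := `|x (lshift d l) 0%N + (-1) ^+ c * x (lshift d l) 1%N|.
apply: (@le_trans _ _ (\sum_(b : {ffun 'I_h -> bool}) \prod_l f l (b l))).
  apply: ler_sum => b _; rewrite normr_prod big_split_ord/= -[leRHS]mulr1.
  apply: ler_pM; rewrite ?prodr_ge0//.
    apply: ler_prod => l _; rewrite normr_ge0/=.
    by rewrite /address_factor -[lshift d l]/(unsplit (inl l)) unsplitK.
  rewrite [leRHS](_ : _ = \prod_(r < d) (1 : R)); last by rewrite big1_eq.
  apply: ler_prod => r _; rewrite normr_ge0/=.
  by rewrite /address_factor -[rshift h r]/(unsplit (inr r)) unsplitK.
rewrite -(bigA_distr_bigA f) -[X in _ <= _ ^+ X]card_ord -prodr_const.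
apply: ler_prod => l _; apply/andP; split.
  by apply: sumr_ge0 => c _; exact: normr_ge0.
rewrite big_bool/= /f expr1 expr0 mul1r mulN1r.
have := coord1 (lshift d l) 0%N; have := coord1 (lshift d l) 1%N.
move: (x _ 0%N) (x _ 1%N) => a b; rewrite !ler_norml => /andP[? ?] /andP[? ?].
have [h1|h1] := ger0P (a - b); have [h2|h2] := ger0P (a + b); lra.
Qed.

(** [b] is the address and [c] picks [e_0] or [e_1] in each of the first [h] variables, which gives
    [4^h] indices. *)
Definition address_index (b c : {ffun 'I_h -> bool}) : {ffun 'I_m -> nat} :=
  [ffun l => match fintype.split l with inl l' => nat_of_bool (c l') | inr r => code r b end].

Hypothesis code_inj : forall b b', (forall r, code r b = code r b') -> b = b'.

(** The codes separate the addresses, so only the term [b] survives, and it is a product of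
    signs. *)
Lemma address_form_unit b c :
  `|address_form (fun l => unitv R (address_index b c l))| = 1.
Proof.
rewrite /address_form (bigD1 b)//= [X in _ + X]big1 ?addr0; last first.
  move=> b' b'b.
  have [r brb] : exists r, code r b != code r b'.
    apply/existsP; apply: contraNT b'b; rewrite negb_exists => /forallP h'.
    by apply/eqP/esym/code_inj => r; apply/eqP; have := h' r; rewrite negbK.
  rewrite (bigD1 (rshift h r))//= [X in X * _](_ : _ = 0) ?mul0r//.
  rewrite /address_factor ffunE -[rshift h r]/(unsplit (inr r)) unsplitK /=.
  by rewrite eq_sym (negbTE brb).
rewrite normr_prod big1// => l _; rewrite /address_factor ffunE.
case: fintype.split => [l'|r] /=; last by rewrite eqxx normr1.
by case: (c l'); rewrite /= ?add0r ?mulr0 ?addr0 ?mulr1 ?normrX ?normrN1 ?expr1n ?normr1.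
Qed.

Lemma address_index_inj : injective (fun p => address_index p.1 p.2).
Proof.
move=> [b c] [b' c'] /= e.
have el l := congr1 (fun f : {ffun 'I_m -> nat} => f l) e.
congr pair.
  apply: code_inj => r; have := el (unsplit (inr r)).
  by rewrite !ffunE !unsplitK.
apply/ffunP => l; have := el (unsplit (inl l)).
by rewrite !ffunE !unsplitK; case: (c l); case: (c' l).
Qed.

Variable M : nat.
Hypothesis code_few : forall b, exists s : seq nat,
  [/\ (size s <= M)%N, 0%N \in s, 1%N \in s & forall r, code r b \in s].
Hypothesis m0 : (0 < m)%N.

Lemma address_index_few b c : few_indices M (address_index b c).
Proof.
have [s [sM s0 s1 sc]] := code_few b.
have : (`I_(size s) #<= `I_M)%card by rewrite card_le_II.
apply: card_le_trans; apply: card_le_trans (card_image_le (nth 0%N s) _).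
apply: subset_card_le => _ [l _ <-].
have : address_index b c l \in s.
  by rewrite ffunE; case: fintype.split => [l'|r]//; case: (c l').
by move=> sl; exists (index (address_index b c l) s); rewrite /= ?index_mem ?nth_index.
Qed.

Lemma address_form_sum :
  ((4 ^+ h)%:E <= restricted_sum (fun x : R => `|x|%R) M address_form)%E.
Proof.
pose r := [seq address_index p.1 p.2 | p : {ffun 'I_h -> bool} * {ffun 'I_h -> bool}].
have ur : uniq r by rewrite map_inj_uniq ?enum_uniq//; exact: address_index_inj.
apply: esum_ge; exists [set` r].
  split; first exact: finite_seq.
  by move=> i /mapP[p _ ->]; exact: address_index_few.
rewrite -fsbig_seq// big_image/= (eq_bigr (fun=> 1%E)) => [|p _]; last first.
  by rewrite address_form_unit powR1.
rewrite sumEFin lee_fin sumr_const card_prod card_ffun card_bool card_ord.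
by rewrite -expnMn natrX.
Qed.

(** With [4^h] coefficients of modulus 1 and norm at most [2^h], the ratio is at least
    [4^(h (m+1) / (2m)) / 2^h = 2^(h/m)]. *)
Lemma optimal_BH_ge_address :
  ((2 `^ (h%:R / m%:R))%:E <= optimal_BH (fun x : R => `|x|%R) m M)%E.
Proof.
apply: le_ereal_inf_tmp => _ [C CBH <-]; rewrite lee_fin.
have := CBH _ multilinear_address_form continuous_address_form.
set N := form_norm _ _ => CN.
have absB := @normr_bounded R.
have N0 : 0 <= N.
  have := abs_le_form_norm absB m0 multilinear_address_form continuous_address_form
    (fun l => norm_sign_vector R (n := 0) (fun=> true)).
  move=> H; exact: (le_trans (normr_ge0 _) H).
have N2 : N <= 2 ^+ h.
  apply: ge_sup; last by move=> _ [x x1 <-]; exact: address_form_le.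
  by eexists; exists (fun=> \sum_v (-1) ^+ (v == ord0 :> 'I_1) *: unitv R v) => // l;
    exact: norm_sign_vector.
pose q : R := m.+1%:R / (2 * m)%:R.
have CNq : (4 ^+ h) `^ q <= C * N.
  rewrite -lee_fin; apply: le_trans CN; rewrite -poweR_EFin.
  have s4 := address_form_sum.
  have s0 := le_trans (_ : (0 <= (4 ^+ h)%:E)%E) s4.
  apply: gt0_ler_poweR => //.
  - by rewrite divr_ge0.
  - by rewrite in_itv/= leey andbT lee_fin exprn_ge0.
  - by rewrite in_itv/= leey andbT s0// lee_fin exprn_ge0.
have mR : (m%:R : R) != 0 by rewrite pnatr_eq0 -lt0n.
have qE : (4 ^+ h) `^ q = 2 `^ (h%:R / m%:R) * 2 ^+ h :> R.
  rewrite (_ : (4 : R) = 2 ^+ 2); last by rewrite -natrX.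
  rewrite -exprM -!powR_mulrn// -powRrM -powRD; last by rewrite pnatr_eq0 implybT.
  congr (_ `^ _); rewrite /q -[m.+1%:R]natr1 [(2 * m)%:R]natrM [(2 * h)%:R]natrM.
  by move: (m%:R) mR => x xN0; field.
rewrite -(@ler_pM2r _ (2 ^+ h)) ?exprn_gt0// -qE.
apply: (le_trans CNq).
(* A constant [C <= 0] is impossible, as [C * N] is positive and [N >= 0]. *)
have [C0|/ltW C0] := leP 0 C; first by rewrite ler_wpM2l.
have : 0 < C * N by apply: lt_le_trans CNq; rewrite powR_gt0// exprn_gt0.
by rewrite ltNge mulr_le0_ge0.
Qed.
End address_form.

Lemma restricted_BH_le (R : realType) (K : numFieldType) (abs : K -> R) m M (C D : R) :
  (forall B : K, exists B' : R, forall z, `|z| <= B -> abs z <= B') ->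
  (forall z, 0 <= abs z) -> (0 < m)%N -> C <= D ->
  restricted_BH abs m M C -> restricted_BH abs m M D.
Proof.
move=> absB abs0 m0 CD HC T mT cT; apply: (le_trans (HC T mT cT)).
rewrite lee_fin ler_wpM2r//.
have H := abs_le_form_norm absB m0 mT cT
  (fun l => norm_sign_vector K (n := 0) (fun=> true)).
exact: (le_trans (abs0 _) H).
Qed.

(** * Limits as [m] tends to infinity *)

Section limits.
Variable R : realType.

Lemma limn_esup_le_cvgr (u : nat -> \bar R) (v : nat -> R) (l : R) :
  (\forall n \near \oo, (u n <= (v n)%:E)%E) -> v n @[n --> \oo] --> l ->
  (limn_esup u <= l%:E)%E.
Proof.
move=> uv vl; apply/lee_addgt0Pr => e e0.
have [N _ HN] : \forall n \near \oo, (u n <= (l + e)%:E)%E.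
  near=> n; apply: (@le_trans _ _ (v n)%:E); first by near: n.
  rewrite lee_fin; near: n; apply: cvgr_le; first exact: vl.
  by rewrite ltrDl.
apply: (@le_trans _ _ (ereal_sup (u @` [set n | (N <= n)%N]))).
  by apply: ereal_inf_lbound; exists [set n | (N <= n)%N] => //; exists N.
by apply: ge_ereal_sup => _ [n Nn <-]; exact: HN.
Unshelve. all: by end_near. Qed.

Lemma limn_einf_ge_cvgr (u : nat -> \bar R) (v : nat -> R) (l : R) :
  (\forall n \near \oo, ((v n)%:E <= u n)%E) -> v n @[n --> \oo] --> l ->
  (l%:E <= limn_einf u)%E.
Proof.
move=> vu vl; rewrite /limn_einf leeNr -EFinN.
apply: (@limn_esup_le_cvgr _ (fun n => - v n)); last exact: cvgN.
by near=> n; rewrite EFinN leeN2; near: n.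
Unshelve. all: by end_near. Qed.

Lemma cvg_powR (f g : nat -> R) (a b : R) : 0 < a ->
  f n @[n --> \oo] --> a -> g n @[n --> \oo] --> b ->
  f n `^ g n @[n --> \oo] --> a `^ b.
Proof.
move=> a0 fa gb; rewrite /powR gt_eqF//.
apply: (@cvg_trans _ (expR (g n * ln (f n)) @[n --> \oo])).
  apply: near_eq_cvg; near=> n; rewrite gt_eqF//.
  near: n; exact: cvgr_gt fa _ a0.
have lnf : ln (f n) @[n --> \oo] --> ln a.
  exact: (continuous_cvg _ (continuous_ln a0) fa).
exact: (continuous_cvg _ (@continuous_expR R (b * ln a)) (cvgM gb lnf)).
Unshelve. all: by end_near. Qed.

Lemma cvg_BH_bound M : BH_bound R m M @[m --> \oo] --> (M%:R ^+ M.+1 : R).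
Proof.
pose K : R := M%:R ^+ M * (M%:R * (2 * 3 ^+ M) + (2 * 3 ^+ M) ^+ M).
pose V : R := M%:R ^+ M.+1.
rewrite -/V -[V]addr0 -[X in _ + X](mulr0 (K - M.+1%:R * V)).
(* Rewrites [(K + (m - M) V) / (m + 1)]; the value of [harmonic] at [m] is [1 / (m + 1)]. *)
apply: (@cvg_trans _ ((V + (K - M.+1%:R * V) * harmonic m) @[m --> \oo])).
  apply: near_eq_cvg; near=> m => /=.
  have Mm : (M <= m)%N by near: m; exact: nbhs_infty_ge.
  rewrite /BH_bound -/K -/V natrB//.
  by rewrite -[m.+1%:R]natr1 -[M.+1%:R]natr1; field; rewrite natr1 pnatr_eq0.
apply: cvgD; first exact: cvg_cst.
by apply: cvgM; [exact: cvg_cst|exact: cvg_harmonic].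
Unshelve. all: by end_near. Qed.

Lemma cvg_BH_exponent : (m.+1%:R / (2 * m)%:R : R) @[m --> \oo] --> (2^-1 : R).
Proof.
apply: (@cvg_trans _ ((2 - 2 * harmonic m : R)^-1 @[m --> \oo])).
  apply: near_eq_cvg; near=> m => /=.
  have m0 : (m%:R : R) != 0.
    by rewrite pnatr_eq0 -lt0n; near: m; exact: nbhs_infty_ge.
  have m1 : (m.+1%:R : R) != 0 by rewrite pnatr_eq0.
  rewrite natrM; move: m1; rewrite -[m.+1%:R]natr1; move: (m%:R) m0 => x x0 x1.
  have -> : 2 - 2 / (x + 1) = 2 * x / (x + 1) by field.
  by rewrite invf_div.
apply: cvgV => //; rewrite -[X in _ --> X]subr0 -[X in _ - X](mulr0 2).
apply: cvgB; first exact: cvg_cst.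
by apply: cvgM; [exact: cvg_cst|exact: cvg_harmonic].
Unshelve. all: by end_near. Qed.

Lemma cvg_powR2_harmonic (x c : R) :
  2 `^ (x - c * harmonic n) @[n --> \oo] --> 2 `^ x.
Proof.
apply: cvg_powR => //; first exact: cvg_cst.
rewrite -[X in _ --> X]subr0 -[X in _ - X](mulr0 c).
apply: cvgB; first exact: cvg_cst.
by apply: cvgM; [exact: cvg_cst|exact: cvg_harmonic].
Qed.

Lemma limn_esup_optimal_BH M : (0 < M)%N ->
  (limn_esup (fun m => optimal_BH (fun x : R => `|x|%R) m M) <=
   (M%:R `^ (M.+1%:R / 2))%:E)%E.
Proof.
move=> M0; apply: (@limn_esup_le_cvgr _
  (fun m => BH_bound R m M `^ (m.+1%:R / (2 * m)%:R))).
  near=> m; apply: ereal_inf_lbound.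
  exists (BH_bound R m M `^ (m.+1%:R / (2 * m)%:R)) => //.
  by apply: restricted_BH_real => //; near: m; exact: nbhs_infty_ge.
rewrite powRrM powR_mulrn//.
apply: cvg_powR; [by rewrite exprn_gt0 ?ltr0n|exact: cvg_BH_bound|exact: cvg_BH_exponent].
Unshelve. all: by end_near. Qed.

(** With [h = m - 1], one address variable holds the rank of [b], so an index has values among [0],
    [1] and this rank. *)
Lemma optimal_BH_ge3 m M : (3 <= M)%N -> (0 < m)%N ->
  ((2 `^ (1 - 2 * harmonic m))%:E <= optimal_BH (fun x : R => `|x|%R) m M)%E.
Proof.
case: m => // h M3 _.
pose code (r : 'I_1) (b : {ffun 'I_h -> bool}) := nat_of_ord (enum_rank b).
have code_inj b b' : (forall r, code r b = code r b') -> b = b'.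
  by move=> /(_ ord0)/val_inj/enum_rank_inj.
have code_few b : exists s : seq nat,
    [/\ (size s <= M)%N, 0%N \in s, 1%N \in s & forall r, code r b \in s].
  exists [:: 0%N; 1%N; code ord0 b]; split; rewrite ?inE ?eqxx//.
  by move=> r; rewrite !inE (ord1 r) eqxx !orbT.
have m'0 : (0 < h + 1)%N by rewrite addn1.
have := optimal_BH_ge_address R code_inj code_few m'0.
rewrite addn1; apply: le_trans; rewrite lee_fin ler_powR ?ler1n//=.
rewrite -subr_ge0.
(* The exponent [1 - 1/m] is relaxed to [1 - 2/(m+1)] to match [harmonic]. *)
have -> : h%:R / h.+1%:R - (1 - 2 / h.+2%:R) = h%:R / (h.+1%:R * h.+2%:R) :> R.
  rewrite -[h.+2%:R]natr1 -[h.+1%:R]natr1; field.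
  by rewrite !natr1 !pnatr_eq0.
by rewrite divr_ge0 ?mulr_ge0.
Qed.

(** With only the values 0 and 1 allowed, each address variable holds one bit of [b]. This needs [h]
    of them, so [h] is half of [m] rounded down; surplus address variables get the code 0. *)
Lemma optimal_BH_ge2 m : (0 < m)%N ->
  ((2 `^ (2^-1 - 1 * harmonic m))%:E <= optimal_BH (fun x : R => `|x|%R) m 2)%E.
Proof.
move=> m0; pose h := m./2.
have h2m : (h + h <= m)%N by rewrite addnn -[leqRHS]odd_double_half leq_addl.
have hm : (h <= m)%N by exact: leq_trans (leq_addr _ _) h2m.
have mE : m = (h + (m - h))%N by rewrite subnKC.
have hd : (h <= m - h)%N by rewrite leq_subRL.
pose code (r : 'I_(m - h)) (b : {ffun 'I_h -> bool}) : nat :=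
  if insub (nat_of_ord r) is Some l then nat_of_bool (b l) else 0%N.
have code_inj b b' : (forall r, code r b = code r b') -> b = b'.
  move=> bb'; apply/ffunP => l.
  have lm : (l < m - h)%N by exact: leq_trans (ltn_ord l) hd.
  have := bb' (Ordinal lm); rewrite /code /= insubT//= => lh; rewrite (_ : Sub _ _ = l).
    by case: (b l); case: (b' l).
  exact/val_inj.
have code_few b : exists s : seq nat,
    [/\ (size s <= 2)%N, 0%N \in s, 1%N \in s & forall r, code r b \in s].
  exists [:: 0%N; 1%N]; split=> // r; rewrite /code.
  by case: insubP => [l _ _|_]//; case: (b l).
have m'0 : (0 < h + (m - h))%N by rewrite -mE.
have := optimal_BH_ge_address R code_inj code_few m'0.
rewrite -mE; apply: le_trans; rewrite lee_fin ler_powR ?ler1n//= mul1r.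
have m1 : (m%:R : R) = (odd m)%:R + 2 * h%:R.
  by rewrite -natrM -natrD mul2n odd_double_half.
have o1 : (odd m)%:R <= 1 :> R by rewrite lern1 leq_b1.
rewrite ler_pdivlMr ?ltr0n// mulrBl -[m.+1%:R]natr1.
have : m%:R / (m%:R + 1) >= 2^-1 :> R.
  rewrite ler_pdivlMr ?ltr_wpDl//; have : 1 <= m%:R :> R by rewrite ler1n.
  by lra.
rewrite [_^-1 * m%:R]mulrC => ?; lra.
Qed.
End limits.

(* The uniform constant and the limiting bounds *)
Local Close Scope classical_set_scope.

Theorem theorem5 (R : realType) (M : nat) (hM : (0 < M)%N) :
  (exists2 eta : R, 1 <= eta & forall m : nat, (M <= m)%N ->
     restricted_BH (fun x : R => `|x|) m M eta /\
     restricted_BH (fun z : R[i] => Normc.normc z) m M eta) /\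
  let C (m : nat) : \bar R := optimal_BH (fun x : R => `|x|) m M in
  ((3 <= M)%N ->
     [/\ (2%:E <= limn_einf C)%E,
         (limn_einf C <= limn_esup C)%E &
         (limn_esup C <= (M%:R `^ (M.+1%:R / 2))%:E)%E]) /\
  (M = 2%N ->
     [/\ ((Num.sqrt 2)%:E <= limn_einf C)%E,
         (limn_einf C <= limn_esup C)%E &
         (limn_esup C <= (Num.sqrt 8)%:E)%E]).
Proof.
split; last split.
- pose V : R := M%:R ^+ M.+1.
  pose K : R := M%:R ^+ M * (M%:R * (2 * 3 ^+ M) + (2 * 3 ^+ M) ^+ M).
  have M1 : 1 <= M%:R :> R by rewrite ler1n.
  have V1 : 1 <= V by rewrite exprn_ege1.
  have K0 : 0 <= K by rewrite !(mulr_ge0, exprn_ge0, addr_ge0).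
  have BKV m : BH_bound R m M <= K + V.
    rewrite /BH_bound -/K -/V mulrDl; apply: lerD.
      by rewrite ler_pdivrMr// ler_peMr// ler1n.
    rewrite mulrAC ler_piMl ?(le_trans ler01)// ler_pdivrMr// mul1r ler_nat.
    by rewrite (leq_trans (leq_subr _ _)).
  exists (8 * (K + V)) => [|m Mm]; first lra.
  have m0 : (0 < m)%N by exact: leq_trans hM Mm.
  have q1 : m.+1%:R / (2 * m)%:R <= 1 :> R.
    by rewrite ler_pdivrMr ?ltr0n ?muln_gt0// mul1r ler_nat mul2n -addnn -addn1 leq_add2l.
  have q0 : 0 <= m.+1%:R / (2 * m)%:R :> R by rewrite divr_ge0.
  have B0 := BH_bound_ge0 R m M.
  have KV1 : 1 <= 8 * (K + V) by lra.
  have le_eta B : 0 <= B -> B <= 8 * (K + V) ->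
      B `^ (m.+1%:R / (2 * m)%:R) <= 8 * (K + V).
    move=> B_ge0 BKV8; apply: (le_trans _ (ler1_powR KV1 q1)).
    by apply: ge0_ler_powR => //; rewrite nnegrE; lra.
  have normc_ge0 (z : R[i]) : 0 <= Normc.normc z by case: z => a b; exact: sqrtr_ge0.
  split.
    apply: (restricted_BH_le (@normr_bounded R) (@normr_ge0 _ R) m0 _
      (restricted_BH_real hM Mm)).
    by apply: le_eta => //; have := BKV m; lra.
  apply: (restricted_BH_le (@normc_bounded R) normc_ge0 m0 _
    (restricted_BH_complex hM Mm)).
  apply: le_eta; first by rewrite !mulr_ge0 ?powR_ge0.
  have p2 : 2 `^ ((2 * m)%:R / m.+1%:R) <= 4 :> R.
    rewrite (_ : 4 = 2 `^ 2%:R); last by rewrite powR_mulrn// -natrX.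
    rewrite ler_powR ?ler1n// ler_pdivrMr ?ltr0n// -natrM ler_nat.
    by rewrite leq_mul2l leqnSn.
  have := powR_ge0 (2 : R) ((2 * m)%:R / m.+1%:R).
  have := BKV m; move: B0 p2; move: (_ `^ _) (BH_bound R m M) => p B B0 p4 BK p0.
  by nra.
- move=> M3; split.
  + rewrite -[X in (X%:E <= _)%E]powRr1//.
    apply: limn_einf_ge_cvgr (@cvg_powR2_harmonic R 1 2).
    by exists 1%N => // m m0; exact: optimal_BH_ge3.
  + exact: limn_einf_sup.
  + exact: limn_esup_optimal_BH.
- move=> M2; subst M; split.
  + rewrite -powR12_sqrt//.
    apply: limn_einf_ge_cvgr (@cvg_powR2_harmonic R _ 1).
    by exists 1%N => // m m0; exact: optimal_BH_ge2.
  + exact: limn_einf_sup.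
  (* Here [2^(3/2)] is the square root of 8. *)
  + have := @limn_esup_optimal_BH R 2 isT.
    by rewrite powRrM powR_mulrn// powR12_sqrt// -natrX.
Qed.
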